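(* Suppose that $g=\mathbf{P}\mu$, where $\mu\in L^\infty(\mathbb{D})$. For $0<q<+\infty$, we then have $$\int_{\mathbb{T}}|g(r\zeta)|^{q}\,\mathrm{d}s(\zeta)\le 10(3+q)^{3/2}\,\|\mu\|_{L^\infty(\mathbb{D})}^q\bigg(\frac{q}{2\mathrm{e}}\bigg)^{q/2}\bigg(\frac{1}{r^4}\log\frac{1}{1-r^2}\bigg)^{q/2},\qquad 0<r<1.$$
   Context: $\mathbb{D}$ is the open unit disk, $\mathbb{T}$ the unit circle, $\mathrm{d}s(z)=|\mathrm{d}z|/(2\pi)$, $\mathrm{d}A(z)=\mathrm{d}x\,\mathrm{d}y/\pi$. The Bergman projection of $\mu$ is $\mathbf{P}\mu(z):=\int_{\mathbb{D}}\frac{\mu(w)}{(1-z\bar w)^2}\,\mathrm{d}A(w)$, $z\in\mathbb{D}$. *)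

(* Defs.v *)
From HB Require Import structures.
From mathcomp Require Import all_boot all_order all_algebra.
From mathcomp Require Import all_classical all_reals all_analysis.
From mathcomp Require Import measurable_realfun complex.

Set Implicit Arguments.
Unset Strict Implicit.
Unset Printing Implicit Defensive.
Import Order.TTheory GRing.Theory Num.Theory.
Import numFieldNormedType.Exports.

Local Open Scope classical_set_scope.
Local Open Scope ring_scope.
Local Open Scope complex_scope.

Section Bergman.
Context {R : realType}.

(* The alias measurableTypeR R of R is the one on which the library puts
   Lebesgue measure. *)
Local Notation plane := (measurableTypeR R * measurableTypeR R)%type.

(* The order on R[i] makes the norm of z an element of R[i]; cmod z is the
   modulus as an element of R. *)
Definition cmod (z : R[i]) : R := complex.Re `|z|.

Definition unit_disc : set R[i] := [set z | cmod z < 1].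

(* R[i] carries no measurable structure, so integration over subsets of the
   complex plane is done on plane = R x R, with its product (Borel) sigma-algebra,
   through the identification of (x, y) with x + iy. *)
Definition of_coords (p : plane) : R[i] := p.1 +i* p.2.

Definition unit_disc_coords : set plane := of_coords @^-1` unit_disc.

Lemma cmodE (z : R[i]) :
  cmod z = Num.sqrt (complex.Re z ^+ 2 + complex.Im z ^+ 2).
Proof. by rewrite /cmod normc_def. Qed.

Lemma measurable_unit_disc_coords : measurable unit_disc_coords.
Proof.
have -> : unit_disc_coords =
    setT `&` (fun p : plane => p.1 ^+ 2 + p.2 ^+ 2) @^-1` `]-oo, 1[.
  rewrite setTI; apply/seteqP; split => -[x y];
    rewrite /unit_disc_coords /unit_disc /= cmodE /= in_itv /=;
    by rewrite -[X in Num.sqrt _ < X]sqrtr1 ltr_sqrt ?ltr01.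
have mf : measurable_fun setT (fun p : plane => p.1 ^+ 2 + p.2 ^+ 2).
  by apply: measurable_funD; apply: measurable_funX;
    [exact: measurable_fst|exact: measurable_snd].
by apply: mf => //; exact: measurable_itv.
Qed.

Definition lebesgue2 : {measure set plane -> \bar R} :=
  (lebesgue_measure \x lebesgue_measure)%E.

Definition Linfty_norm_disc (mu : R[i] -> R[i]) : \bar R :=
  Lnorm (mrestr lebesgue2 measurable_unit_disc_coords) +oo%E
    (fun p => (cmod (mu (of_coords p)))%:E).

(* Functions stand for their almost-everywhere classes; every class has a Borel
   representative. *)
Definition Linfty_disc (mu : R[i] -> R[i]) : Prop :=
  [/\ measurable_fun unit_disc_coords (fun p => complex.Re (mu (of_coords p))),
      measurable_fun unit_disc_coords (fun p => complex.Im (mu (of_coords p)))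
    & (Linfty_norm_disc mu < +oo)%E].

(* Integral over the unit disc against dA = dx dy / pi. *)
Definition disc_integral (f : R[i] -> R[i]) : R[i] :=
  (pi^-1 * \int[lebesgue2]_(p in unit_disc_coords)
             complex.Re (f (of_coords p))) +i*
  (pi^-1 * \int[lebesgue2]_(p in unit_disc_coords)
             complex.Im (f (of_coords p))).

Definition bergman_projection (mu : R[i] -> R[i]) (z : R[i]) : R[i] :=
  disc_integral (fun w => mu w / (1 - z * w^*) ^+ 2).

(* Integral over the unit circle against ds = |dz| / (2 pi). *)
Definition circle_integral (f : R[i] -> \bar R) : \bar R :=
  (((2 * pi)^-1)%:E *
    \int[lebesgue_measure]_(t in `[0%R, (2 * pi)%R]) f (cos t +i* sin t))%E.

End Bergman.

(* Main.v *)
Require Import Defs.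
From mathcomp Require Import all_boot all_order all_algebra.
From mathcomp Require Import all_classical all_reals all_analysis.
From mathcomp Require Import complex measurable_realfun ess_sup_inf.
From mathcomp Require Import ring lra.

(* The entropy method. On |w| < 1/r let V be the Poisson extension of a positive
   density v on N equidistant nodes zeta_k of the circle, with Z = mean v, so
   that Re sum (z g(z)) v_k is the integral of mu against dV/dw. By
   Cauchy-Schwarz with weight V / (1 - r^2 |w|^2), and Green's formula for
   V ln V (whose Laplacian is |grad V|^2 / V), this pairing is at most
   |mu|_oo sqrt(L Z Ent v), L = r^-2 ln (1/(1-r^2)), up to errors that vanish
   as N grows. For v = exp (t phi), phi = Re (lambda z g(z)), one has
   Ent v = mean (v ln v) - Z ln Z, and the inequality reads
   ln Z <= t^2 |mu|_oo^2 L / 4. Optimizing over t bounds the q-th moments of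
   the positive part of phi; O(q) directions lambda bound those of |z g(z)|,
   and averaging over rotations of the nodes gives the integral over the
   circle. *)

Set Implicit Arguments.
Unset Strict Implicit.
Unset Printing Implicit Defensive.
Import Order.TTheory GRing.Theory Num.Theory.
Import numFieldNormedType.Exports.
Local Open Scope classical_set_scope.
Local Open Scope ring_scope.

(** * Integrals over discs *)

(** Finitely many nodes make [V] a finite sum of explicit rational functions, so every derivative is
    algebraic. The price is that the Poisson kernels of the nodes average to 1 only approximately;
    an average of at most 2 suffices, since it costs a factor 2 in each exponential moment, which
    the constant 10 absorbs. The kernels are singular on |w| = 1/r, hence the work is done on a disc
    of radius [rho] with 1 < rho < 1/r: it contains the unit disc, where mu lives, and [rho] is so
    close to 1/r that L grows at most by a factor 2^(1/q), which costs sqrt 2 in the end. The number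
    L is the integral of dA / (1 - r^2 |w|^2) over the unit disc. The pairing is with z g because
    alpha / (1 - alpha w)^2 is exactly dP/dw for the Poisson kernel P; dividing by |z| = r at the
    end supplies the second r^(-2) of r^(-4). What is left of the constant is the number of
    directions, about 2 q, and the loss from using finitely many of them. *)

Section PointwiseDerivatives.
Context {R : realType}.
Implicit Types (f g : R -> R) (x : R).

(* Not a class, unlike [is_derive]: [apply] leaves unknown derivatives to be
   computed by the rules below. *)
Definition has_deriv f x (d : R) : Prop := is_derive x 1 f d.

Lemma has_deriv_eq f x d d' : has_deriv f x d -> d = d' -> has_deriv f x d'.
Proof. by move=> h <-. Qed.

Lemma has_derivD f g x df dg : has_deriv f x df -> has_deriv g x dg ->
  has_deriv (fun t => f t + g t) x (df + dg).
Proof. by rewrite /has_deriv => hf hg; exact: is_deriveD. Qed.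

Lemma has_derivN f x df : has_deriv f x df ->
  has_deriv (fun t => - f t) x (- df).
Proof. by rewrite /has_deriv => hf; exact: is_deriveN. Qed.

Lemma has_derivM f g x df dg : has_deriv f x df -> has_deriv g x dg ->
  has_deriv (fun t => f t * g t) x (f x * dg + g x * df).
Proof. by rewrite /has_deriv => hf hg; exact: is_deriveM. Qed.

Lemma has_deriv_cst (c x : R) : has_deriv (fun=> c) x 0.
Proof. by rewrite /has_deriv; exact: is_derive_cst. Qed.

Lemma has_deriv_id x : has_deriv (fun t => t) x 1.
Proof. by rewrite /has_deriv; exact: is_derive_id. Qed.

Lemma has_derivX f n x df : has_deriv f x df ->
  has_deriv (fun t => f t ^+ n) x (n%:R * f x ^+ n.-1 * df).
Proof.
by rewrite /has_deriv => hf; have := is_deriveX n hf; rewrite exprfctE.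
Qed.

Lemma has_derivV f x df : f x != 0 -> has_deriv f x df ->
  has_deriv (fun t => (f t)^-1) x (- (f x) ^- 2 * df).
Proof. by rewrite /has_deriv => f0 hf; exact: is_deriveV. Qed.

Lemma has_deriv_ln f x df : 0 < f x -> has_deriv f x df ->
  has_deriv (fun t => ln (f t)) x (df / f x).
Proof.
rewrite /has_deriv => f0 hf; have := is_derive1_ln f0 => hl.
by have := is_derive1_comp hl hf; rewrite mulrC.
Qed.

Lemma has_derivB f g x df dg : has_deriv f x df -> has_deriv g x dg ->
  has_deriv (fun t => f t - g t) x (df - dg).
Proof. by move=> hf hg; apply: has_derivD => //; exact: has_derivN. Qed.

Lemma has_derivZ c f x df : has_deriv f x df ->
  has_deriv (fun t => c * f t) x (c * df).
Proof.
move=> hf; apply: has_deriv_eq.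
  by apply: has_derivM; [exact: has_deriv_cst|exact: hf].
by rewrite mulr0 addr0.
Qed.

Lemma has_deriv_sum n (f : 'I_n -> R -> R) x (df : 'I_n -> R) :
  (forall k, has_deriv (f k) x (df k)) ->
  has_deriv (fun t => \sum_(k < n) f k t) x (\sum_(k < n) df k).
Proof.
rewrite /has_deriv => hf; have := is_derive_sum hf.
by congr is_derive; apply/funext => t; rewrite fct_sumE.
Qed.

Lemma has_deriv_continuous f x df : has_deriv f x df -> {for x, continuous f}.
Proof. by rewrite /has_deriv => -[hf _]; apply/differentiable_continuous/derivable1_diffP. Qed.

End PointwiseDerivatives.

Section DiscIntegrals.
Context {R : realType}.
Local Notation plane := (measurableTypeR R * measurableTypeR R)%type.
Implicit Types (rho x y : R) (f g F : R -> R -> R).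

Definition disc rho : set plane := [set p | p.1 ^+ 2 + p.2 ^+ 2 < rho ^+ 2].

Definition disc_int rho f : R :=
  \int[lebesgue2]_(p in disc rho) f p.1 p.2.

(** A sufficient condition for integrability that is stable under sums and products, so that
    integrability side conditions reduce to closure lemmas. *)
Definition disc_bounded rho f :=
  measurable_fun (disc rho) (fun p : plane => f p.1 p.2) /\
  exists M, forall x y, x ^+ 2 + y ^+ 2 < rho ^+ 2 -> `|f x y| <= M.

Lemma measurable_disc rho : measurable (disc rho).
Proof.
have -> : disc rho =
    setT `&` (fun p : plane => p.1 ^+ 2 + p.2 ^+ 2) @^-1` `]-oo, rho ^+ 2[.
  by rewrite setTI; apply/seteqP; split => -[x y]; rewrite /disc /= in_itv.
have mf : measurable_fun setT (fun p : plane => p.1 ^+ 2 + p.2 ^+ 2).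
  by apply: measurable_funD; apply: measurable_funX;
    [exact: measurable_fst|exact: measurable_snd].
by apply: mf => //; exact: measurable_itv.
Qed.

Lemma sqr_lt_itv x h : 0 <= h -> (x ^+ 2 < h ^+ 2) = (- h < x < h).
Proof.
by move=> h0; rewrite -ltr_norml -[RHS](ltr_pXn2r (n := 2)) ?nnegrE// real_normK ?num_real.
Qed.

Lemma disc_finite rho : 0 < rho -> (lebesgue2 (disc rho) < +oo)%E.
Proof.
move=> rho0; pose I : set (measurableTypeR R) := [set` `]-rho, rho[].
have sub : disc rho `<=` I `*` I.
  move=> [x y]; rewrite /disc /I/= !in_itv/= => h.
  by rewrite -!sqr_lt_itv ?(ltW rho0)//; split; nra.
apply: (@le_lt_trans _ _ (lebesgue2 (I `*` I))).
  by apply: le_measure => //; rewrite inE; [exact: measurable_disc|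
    apply: measurableX; exact: measurable_itv].
rewrite /lebesgue2/= product_measure1E; [|exact: measurable_itv..].
have IE := lebesgue_measure_itv `]-rho, rho[; rewrite [X in (X * X)%E]IE/=.
by rewrite lte_fin; case: ifP => _; rewrite ?mule0 -?EFinD -?EFinM ?ltry.
Qed.

Lemma disc_integrable rho f : 0 < rho -> disc_bounded rho f ->
  lebesgue2.-integrable (disc rho) (EFin \o (fun p : plane => f p.1 p.2)).
Proof.
move=> rho0 [mf [M fM]].
apply: measurable_bounded_integrable => //.
- exact: measurable_disc.
- exact: disc_finite.
- exists M; split; first by rewrite num_real.
  by move=> N MN [x y] Dp /=; rewrite (le_trans (fM _ _ Dp))// ltW.
Qed.

(** Two-sided derivatives at the endpoints are affordable because all functions here are smooth
    slightly beyond the closed disc. The interval is open because it is a chord of an open disc. *)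
Lemma FTC2_le (a b : R) (F f : R -> R) : a < b ->
  (forall x, a <= x <= b -> has_deriv F x (f x)) ->
  (forall x, a <= x <= b -> {for x, continuous f}) ->
  (\int[lebesgue_measure]_(x in `]a, b[) (f x)%:E)%E = (F b - F a)%:E.
Proof.
move=> ab dF cf.
have cF x : a <= x <= b -> {for x, continuous F}.
  by move=> /dF h; exact: has_deriv_continuous h.
have wf : {within `[a, b], continuous f}.
  by apply: continuous_in_subspaceT => x; rewrite inE/= in_itv/=; exact: cf.
rewrite -(@integral_itv_bndoo _ _ _ _ true false); last first.
  apply/measurable_EFinP; apply: open_continuous_measurable_fun => // x.
  by rewrite inE/= in_itv/= => /andP[ax xb]; apply: cf; rewrite !ltW.
rewrite (@continuous_FTC2 _ f F)// ?EFinB//.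
- split.
  + by move=> x; rewrite in_itv/= => /andP[ax xb]; have [] := dF x; rewrite ?ltW.
  + by apply: cvg_at_right_filter; apply: cF; rewrite lexx ltW.
  + by apply: cvg_at_left_filter; apply: cF; rewrite lexx ltW.
- move=> x; rewrite in_itv/= => /andP[ax xb].
  by rewrite derive1E; apply: @derive_val; apply: dF; rewrite !ltW.
Qed.

Lemma disc_int_iterated rho g : 0 < rho -> disc_bounded rho g ->
  (disc_int rho g)%:E = (\int[lebesgue_measure]_y \int[lebesgue_measure]_x
     (((fun p : plane => (g p.1 p.2)%:E) \_ (disc rho)) (x, y)))%E /\
  (disc_int rho g)%:E = (\int[lebesgue_measure]_x \int[lebesgue_measure]_y
     (((fun p : plane => (g p.1 p.2)%:E) \_ (disc rho)) (x, y)))%E.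
Proof.
move=> rho0 bg; have ig := disc_integrable rho0 bg.
have ig' : lebesgue2.-integrable setT
    ((fun p : plane => (g p.1 p.2)%:E) \_ (disc rho)).
  by apply/(integrable_mkcond _ (measurable_disc rho)).
have E : (disc_int rho g)%:E =
   (\int[lebesgue2]_p ((fun p : plane => (g p.1 p.2)%:E) \_ (disc rho)) p)%E.
  rewrite -integral_mkcond /disc_int /Rintegral fineK//.
  by apply: integrable_fin_num => //; exact: measurable_disc.
split; first by rewrite E -(integral21_prod_meas1 ig').
by rewrite E -(integral12_prod_meas1 ig').
Qed.

(** The chord is []-h, h[] and the integral is [F h - F (- h)]. The sign condition says that the
    flux is outward at both ends, that is [F (- h) <= 0 <= F h]. Keeping only this sign avoids
    boundary integrals altogether. *)
Lemma chord_integral rho (F f : R -> R) y : 0 < rho ->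
  (forall x, x ^+ 2 + y ^+ 2 <= rho ^+ 2 -> has_deriv F x (f x)) ->
  (forall x, x ^+ 2 + y ^+ 2 <= rho ^+ 2 -> {for x, continuous f}) ->
  (forall x, x ^+ 2 + y ^+ 2 = rho ^+ 2 -> 0 <= x * F x) ->
  (0 <= \int[lebesgue_measure]_x
    (if (x ^+ 2 + y ^+ 2 < rho ^+ 2)%R then (f x)%:E else 0))%E.
Proof.
move=> rho0 dF cf bF.
have [yr|ry] := ltP (y ^+ 2) (rho ^+ 2); last first.
  apply: integral_ge0 => x _; case: ifPn => // lx; exfalso.
  by have := sqr_ge0 (x : R); lra.
pose h := Num.sqrt (rho ^+ 2 - y ^+ 2).
have h0 : 0 < h by rewrite sqrtr_gt0; lra.
have hE : h ^+ 2 = rho ^+ 2 - y ^+ 2 by rewrite sqr_sqrtr; lra.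
have hF : F (- h) <= F h.
  have := bF h; have := bF (- h); rewrite sqrrN hE subrK => /(_ erefl) A /(_ erefl) B.
  have {}B : 0 <= F h by rewrite -(pmulr_rge0 _ h0).
  by rewrite (le_trans _ B)// -oppr_ge0 -(pmulr_rge0 _ h0) mulrN -mulNr.
suff -> : (\int[lebesgue_measure]_x
    (if (x ^+ 2 + y ^+ 2 < rho ^+ 2)%R then (f x)%:E else 0))%E = (F h - F (- h))%:E.
  by rewrite lee_fin subr_ge0.
have dom x : - h <= x <= h -> x ^+ 2 + y ^+ 2 <= rho ^+ 2.
  rewrite -ler_norml -(ler_pXn2r (n := 2)) ?nnegrE ?(ltW h0)// real_normK ?num_real// hE.
  lra.
transitivity (\int[lebesgue_measure]_(x in `](- h)%R, h[) (f x)%:E)%E; last first.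
  apply: FTC2_le => [|x /dom|x /dom]; [lra|exact: dF|exact: cf].
rewrite [RHS]integral_mkcond; apply: eq_integral => x _.
rewrite patchE; congr (if _ then _ else _).
apply/idP/idP.
  by move=> lx; rewrite inE/= in_itv/= -sqr_lt_itv ?ltW// hE; lra.
by rewrite inE/= in_itv/= -sqr_lt_itv ?ltW// hE; lra.
Qed.

Lemma disc_int_ge0_x rho F g : 0 < rho -> disc_bounded rho g ->
  (forall x y, x ^+ 2 + y ^+ 2 <= rho ^+ 2 -> has_deriv (F^~ y) x (g x y)) ->
  (forall x y, x ^+ 2 + y ^+ 2 <= rho ^+ 2 -> {for x, continuous (g^~ y)}) ->
  (forall x y, x ^+ 2 + y ^+ 2 = rho ^+ 2 -> 0 <= x * F x y) ->
  0 <= disc_int rho g.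
Proof.
move=> rho0 bg dF cg bF; rewrite -lee_fin (disc_int_iterated rho0 bg).1.
apply: integral_ge0 => y _.
have := @chord_integral rho (F^~ y) (g^~ y) y rho0 (dF ^~ y) (cg ^~ y) (bF ^~ y).
congr (0 <= _)%E; apply: eq_integral => x _; rewrite patchE.
congr (if _ then _ else _).
by apply/idP/idP; rewrite ?inE /disc.
Qed.

Lemma disc_int_ge0_y rho F g : 0 < rho -> disc_bounded rho g ->
  (forall x y, x ^+ 2 + y ^+ 2 <= rho ^+ 2 -> has_deriv (F x) y (g x y)) ->
  (forall x y, x ^+ 2 + y ^+ 2 <= rho ^+ 2 -> {for y, continuous (g x)}) ->
  (forall x y, x ^+ 2 + y ^+ 2 = rho ^+ 2 -> 0 <= y * F x y) ->
  0 <= disc_int rho g.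
Proof.
move=> rho0 bg dF cg bF; rewrite -lee_fin (disc_int_iterated rho0 bg).2.
apply: integral_ge0 => x _.
have : (0 <= \int[lebesgue_measure]_y
     (if (y ^+ 2 + x ^+ 2 < rho ^+ 2)%R then (g x y)%:E else 0))%E.
  by apply: (@chord_integral rho (F x) (g x) x) => // y; rewrite addrC;
    [exact: dF|exact: cg|exact: bF].
congr (0 <= _)%E; apply: eq_integral => y _; rewrite patchE addrC.
congr (if _ then _ else _).
by apply/idP/idP; rewrite ?inE /disc.
Qed.

End DiscIntegrals.

(** * Closure properties, linearity of the integral, and the area of a disc *)

Section DiscIntegralTheory.
Context {R : realType}.
Local Notation plane := (measurableTypeR R * measurableTypeR R)%type.
Variable rho : R.
Hypothesis rho0 : 0 < rho.
Implicit Types (x y : R) (f g F : R -> R -> R).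

Lemma disc_bounded_cst (c : R) : disc_bounded rho (fun _ _ => c).
Proof. by split; [exact: measurable_cst|exists `|c|]. Qed.

Lemma disc_bounded_fst : disc_bounded rho (fun x _ => x).
Proof.
split; first by apply: measurable_funTS; exact: measurable_fst.
exists rho => x y xy; rewrite -(ler_pXn2r (n := 2)) ?nnegrE ?(ltW rho0)//.
by rewrite real_normK ?num_real//; nra.
Qed.

Lemma disc_bounded_snd : disc_bounded rho (fun _ y => y).
Proof.
split; first by apply: measurable_funTS; exact: measurable_snd.
exists rho => x y xy; rewrite -(ler_pXn2r (n := 2)) ?nnegrE ?(ltW rho0)//.
by rewrite real_normK ?num_real//; nra.
Qed.

Lemma disc_boundedD f g : disc_bounded rho f -> disc_bounded rho g ->
  disc_bounded rho (fun x y => f x y + g x y).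
Proof.
move=> [mf [M fM]] [mg [N gN]]; split; first exact: measurable_funD.
by exists (M + N) => x y xy; rewrite (le_trans (ler_normD _ _))// lerD ?fM ?gN.
Qed.

Lemma disc_boundedM f g : disc_bounded rho f -> disc_bounded rho g ->
  disc_bounded rho (fun x y => f x y * g x y).
Proof.
move=> [mf [M fM]] [mg [N gN]]; split; first exact: measurable_funM.
by exists (M * N) => x y xy; rewrite normrM ler_pM ?fM ?gN.
Qed.

Lemma disc_boundedN f : disc_bounded rho f ->
  disc_bounded rho (fun x y => - f x y).
Proof.
move=> [mf [M fM]]; split; first exact: measurable_funN.
by exists M => x y xy; rewrite normrN fM.
Qed.

Lemma disc_boundedB f g : disc_bounded rho f -> disc_bounded rho g ->
  disc_bounded rho (fun x y => f x y - g x y).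
Proof. by move=> bf bg; apply: disc_boundedD => //; exact: disc_boundedN. Qed.

Lemma disc_boundedX f n : disc_bounded rho f ->
  disc_bounded rho (fun x y => f x y ^+ n).
Proof.
move=> bf; elim: n => [|n IH]; first exact: disc_bounded_cst.
under eq_fun do under eq_fun do rewrite exprS.
exact: disc_boundedM.
Qed.

Lemma disc_bounded_sum n (f : 'I_n -> R -> R -> R) :
  (forall k, disc_bounded rho (f k)) ->
  disc_bounded rho (fun x y => \sum_(k < n) f k x y).
Proof.
move=> bf; elim: n f bf => [|n IH] f bf.
  under eq_fun do under eq_fun do rewrite big_ord0.
  exact: disc_bounded_cst.
under eq_fun do under eq_fun do rewrite big_ord_recr/=.
by apply: disc_boundedD => //; exact: IH.
Qed.

Lemma disc_bounded_comp (h : R -> R) f M :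
  measurable_fun setT h -> disc_bounded rho f ->
  (forall x y, x ^+ 2 + y ^+ 2 < rho ^+ 2 -> `|h (f x y)| <= M) ->
  disc_bounded rho (fun x y => h (f x y)).
Proof.
move=> mh [mf _] hM; split; last by exists M.
exact: (measurableT_comp mh mf).
Qed.

Lemma eq_disc_bounded f g :
  (forall x y, x ^+ 2 + y ^+ 2 < rho ^+ 2 -> f x y = g x y) ->
  disc_bounded rho f -> disc_bounded rho g.
Proof.
move=> fg [mf [M fM]]; split.
  by apply: eq_measurable_fun mf => -[x y]; rewrite inE => /fg.
by exists M => x y xy; rewrite -fg// fM.
Qed.

Lemma disc_boundedV f (e : R) : 0 < e -> disc_bounded rho f ->
  (forall x y, x ^+ 2 + y ^+ 2 < rho ^+ 2 -> e <= f x y) ->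
  disc_bounded rho (fun x y => (f x y)^-1).
Proof.
move=> e0 bf fe.
(* For positive values the inverse is the power of exponent -1, whose measurability is at hand. *)
apply: (@eq_disc_bounded (fun x y => f x y `^ (-1))).
  by move=> x y xy; rewrite powR_inv1// (le_trans _ (fe _ _ xy))// ltW.
apply: (@disc_bounded_comp (fun z => z `^ (-1)) _ e^-1) => //.
move=> x y xy; have fp : 0 < f x y := lt_le_trans e0 (fe _ _ xy).
rewrite (powR_inv1 (ltW fp)) gtr0_norm ?invr_gt0//.
by rewrite lef_pV2 ?posrE// fe.
Qed.

Lemma disc_bounded_ln f (e : R) : 0 < e -> disc_bounded rho f ->
  (forall x y, x ^+ 2 + y ^+ 2 < rho ^+ 2 -> e <= f x y) ->
  disc_bounded rho (fun x y => ln (f x y)).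
Proof.
move=> e0 bf fe; have [_ [N fN]] := bf.
apply: (@disc_bounded_comp (@ln R) _ (`|ln e| + `|ln `|N| |)) => //.
move=> x y xy; have fp : 0 < f x y := lt_le_trans e0 (fe _ _ xy).
have fN' : f x y <= `|N|.
  by rewrite (le_trans (ler_norm _))// (le_trans (fN _ _ xy))// ler_norm.
have := ler_norm (ln `|N|); have := ler_norm (- ln e); rewrite normrN.
have := normr_ge0 (ln `|N|); have := normr_ge0 (ln e).
have : ln e <= ln (f x y) by rewrite ler_ln ?posrE// fe.
have : ln (f x y) <= ln `|N| by rewrite ler_ln ?posrE// (lt_le_trans fp).
by rewrite ler_norml => *; apply/andP; split; lra.
Qed.

Lemma eq_disc_int f g :
  (forall x y, x ^+ 2 + y ^+ 2 < rho ^+ 2 -> f x y = g x y) ->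
  disc_int rho f = disc_int rho g.
Proof.
by move=> fg; apply: eq_Rintegral => -[x y]; rewrite inE => /fg.
Qed.

Lemma disc_intD f g : disc_bounded rho f -> disc_bounded rho g ->
  disc_int rho (fun x y => f x y + g x y) = disc_int rho f + disc_int rho g.
Proof.
move=> bf bg; apply: RintegralD; [exact: measurable_disc| | ];
exact: disc_integrable.
Qed.

Lemma disc_intB f g : disc_bounded rho f -> disc_bounded rho g ->
  disc_int rho (fun x y => f x y - g x y) = disc_int rho f - disc_int rho g.
Proof.
move=> bf bg; apply: RintegralB; [exact: measurable_disc| | ];
exact: disc_integrable.
Qed.

Lemma disc_intZ c f : disc_bounded rho f ->
  disc_int rho (fun x y => c * f x y) = c * disc_int rho f.
Proof.
move=> bf; apply: RintegralZl; [exact: measurable_disc|].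
exact: disc_integrable.
Qed.

Lemma disc_int_sum n (f : 'I_n -> R -> R -> R) :
  (forall k, disc_bounded rho (f k)) ->
  disc_int rho (fun x y => \sum_(k < n) f k x y) = \sum_(k < n) disc_int rho (f k).
Proof.
move=> bf; elim: n f bf => [|n IH] f bf.
  rewrite big_ord0 -[RHS](mul0r (disc_int rho (fun _ _ => 0))).
  rewrite -disc_intZ; last exact: disc_bounded_cst.
  by apply: eq_disc_int => x y _; rewrite big_ord0 mul0r.
rewrite big_ord_recr/= -IH// -disc_intD//; last exact: disc_bounded_sum.
by apply: eq_disc_int => x y _; rewrite big_ord_recr.
Qed.

Lemma le_disc_int f g : disc_bounded rho f -> disc_bounded rho g ->
  (forall x y, x ^+ 2 + y ^+ 2 < rho ^+ 2 -> f x y <= g x y) ->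
  disc_int rho f <= disc_int rho g.
Proof.
move=> bf bg fg; apply: le_Rintegral.
- exact: measurable_disc.
- exact: disc_integrable.
- exact: disc_integrable.
- by move=> [x y]; exact: fg.
Qed.

(** Fubini reduces the area to the chord lengths [2 sqrt (rho^2 - y^2)]; the substitution
    [y = rho sin t] turns these into [2 rho^2 cos^2 t], with antiderivative
    [rho^2 (t + sin t cos t)]. *)
Lemma disc_area : disc_int rho (fun _ _ => 1) = pi * rho ^+ 2.
Proof.
apply: EFin_inj; rewrite (disc_int_iterated rho0 (disc_bounded_cst 1)).1.
pose H y := 2 * Num.sqrt (rho ^+ 2 - y ^+ 2).
pose s y := Num.sqrt (rho ^+ 2 - y ^+ 2).
have p2 : 0 < (pi / 2 : R) by rewrite divr_gt0 ?pi_gt0.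
transitivity (\int[lebesgue_measure]_(y in `[(rho * sin (- (pi / 2)))%R, (rho * sin (pi / 2))%R]) (H y)%:E)%E.
  rewrite sinN sin_pihalf mulrN mulr1 [RHS]integral_mkcond.
  apply: eq_integral => y _; rewrite patchE.
  have E : (\int[lebesgue_measure]_x
      (((fun p : plane => (1 : R)%:E) \_ (disc rho)) (x, y)))%E =
      (\int[lebesgue_measure]_(x in `](- s y)%R, s y[) 1)%E.
    rewrite [RHS]integral_mkcond; apply: eq_integral => x _; rewrite !patchE.
    congr (if _ then _ else _); apply/idP/idP; rewrite !inE /disc/= in_itv/= /s.
      move=> lt; rewrite -sqr_lt_itv ?sqrtr_ge0// sqr_sqrtr; first by lra.
      by have := sqr_ge0 (x : R); lra.
    rewrite -sqr_lt_itv ?sqrtr_ge0//.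
    (* Off the disc [Num.sqrt] of a negative number is 0, so the chord []-s y, s y[] is empty, as it
       should be. *)
    have [yr|yr] := leP (y ^+ 2) (rho ^+ 2); first by rewrite sqr_sqrtr; lra.
    rewrite ler0_sqrtr; last by lra.
    by have := sqr_ge0 (x : R); lra.
  rewrite E integral_cst ?mul1e; last exact: measurable_itv.
  have L := lebesgue_measure_itv `](- s y)%R, s y[; rewrite [LHS]L.
  rewrite /= lte_fin /s.
  case: ifPn => [_|].
    case: ifPn => [_|]; first by rewrite -EFinD /H; congr EFin; lra.
    rewrite notin_setE/= in_itv/= => ny; rewrite -EFinD; congr EFin.
    rewrite ler0_sqrtr ?oppr0 ?addr0//.
    rewrite leNgt; apply/negP => lt; apply: ny.
    by rewrite -ler_norml -(ler_pXn2r (n := 2)) ?nnegrE ?(ltW rho0)// real_normK ?num_real//; lra.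
  rewrite -leNgt => le.
  have s0 : Num.sqrt (rho ^+ 2 - y ^+ 2) = 0.
    by apply/eqP; rewrite eq_le sqrtr_ge0 andbT; lra.
  by case: ifPn => // _; rewrite /H s0 mulr0.
have dF (x : R) : is_derive x 1 (fun t => rho * sin t) (rho * cos x).
  exact: is_deriveZ.
have derF : (fun t : R => rho * sin t)^`()%classic = fun x => rho * cos x.
  by apply/funext => x; rewrite derive1E; apply: derive_val.
have ccos : continuous (fun x : R => rho * cos x).
  by move=> x; apply: cvgM; [exact: cvg_cst|exact: continuous_cos].
have csin : continuous (fun x : R => rho * sin x).
  by move=> x; apply: cvgM; [exact: cvg_cst|exact: continuous_sin].
rewrite (integration_by_substitution_increasing (F := fun t => rho * sin t)); last first.
- apply: continuous_subspaceT => x; apply: cvgM; first exact: cvg_cst.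
  apply: (@continuous_comp _ _ _ (fun y => rho ^+ 2 - y ^+ 2) (@Num.sqrt R)); last exact: sqrt_continuous.
  by apply: cvgB; [exact: cvg_cst|exact: exprn_continuous].
- split.
  + by move=> x _; have [] := dF x.
  + by apply: cvg_at_right_filter; exact: csin.
  + by apply: cvg_at_left_filter; exact: csin.
- by rewrite derF; apply/cvg_ex; exists (rho * cos (pi / 2)); apply: cvg_at_left_filter; exact: ccos.
- by rewrite derF; apply/cvg_ex; exists (rho * cos (- (pi / 2))); apply: cvg_at_right_filter; exact: ccos.
- by rewrite derF => x _; exact: ccos.
- by move=> x y xI yI xy; rewrite ltr_pM2l// ltr_sin.
- lra.
rewrite derF.
transitivity (\int[lebesgue_measure]_(x in `[(- (pi / 2))%R, (pi / 2)%R])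
   (rho ^+ 2 * (2 * cos x ^+ 2))%:E)%E.
  apply: eq_integral => x; rewrite inE/= in_itv/= => xI; congr EFin; rewrite /H/=.
  suff : 2 * Num.sqrt (rho ^+ 2 - (rho * sin x) ^+ 2) * (rho * cos x) =
      rho ^+ 2 * (2 * cos x ^+ 2) by [].
  have -> : rho ^+ 2 - (rho * sin x) ^+ 2 = (rho * cos x) ^+ 2.
    by rewrite !exprMn sin2cos2; ring.
  rewrite sqrtr_sqr ger0_norm; first by ring.
  by rewrite mulr_ge0 ?(ltW rho0)// cos_ge0_pihalf.
rewrite (@integral_itv_bndoo _ _ _ _ true false); last first.
  apply/measurable_EFinP; apply: measurable_funTS; apply: continuous_measurable_fun.
  move=> x; apply: cvgM; first exact: cvg_cst.
  apply: cvgM; first exact: cvg_cst.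
  by apply: (@continuous_comp _ _ _ cos (fun y : R => y ^+ 2)); [exact: continuous_cos|exact: exprn_continuous].
pose A (t : R) := rho ^+ 2 * (t + sin t * cos t).
transitivity ((A (pi / 2) - A (- (pi / 2)))%:E); last first.
  by rewrite /A cosN cos_pihalf; congr EFin; field.
apply: FTC2_le.
- lra.
- move=> x _; apply: has_deriv_eq.
    apply: has_derivZ; apply: has_derivD; first exact: has_deriv_id.
    by apply: has_derivM; [exact: is_derive_sin|exact: is_derive_cos].
  by rewrite -[X in X + (_ + _)](cos2Dsin2 x); ring.
- move=> x _; apply: cvgM; first exact: cvg_cst.
  apply: cvgM; first exact: cvg_cst.
  by apply: (@continuous_comp _ _ _ cos (fun y : R => y ^+ 2)); [exact: continuous_cos|exact: exprn_continuous].
Qed.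

End DiscIntegralTheory.

(** * The divergence theorem on a disc *)

Section Divergence.
Context {R : realType}.
Local Notation plane := (measurableTypeR R * measurableTypeR R)%type.
Variable rho : R.
Hypothesis rho0 : 0 < rho.
Implicit Types (x y : R) (f g X Y : R -> R -> R).

(** Continuity is asked along horizontal and vertical lines only: this is what the fundamental
    theorem needs on chords, and joint measurability comes with [disc_bounded]. *)
Definition disc_regular f :=
  disc_bounded rho f /\ forall x y, x ^+ 2 + y ^+ 2 <= rho ^+ 2 ->
    {for x, continuous (f^~ y)} /\ {for y, continuous (f x)}.

Lemma disc_regular_cst (c : R) : disc_regular (fun _ _ => c).
Proof.
by split; [exact: disc_bounded_cst|move=> x y _; split; exact: cvg_cst].
Qed.

Lemma disc_regular_fst : disc_regular (fun x _ => x).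
Proof.
split; [exact: disc_bounded_fst|move=> x y _; split].
  exact: cvg_id.
exact: cvg_cst.
Qed.

Lemma disc_regular_snd : disc_regular (fun _ y => y).
Proof.
split; [exact: disc_bounded_snd|move=> x y _; split].
  exact: cvg_cst.
exact: cvg_id.
Qed.

Lemma disc_regularD f g : disc_regular f -> disc_regular g ->
  disc_regular (fun x y => f x y + g x y).
Proof.
move=> [bf cf] [bg cg]; split; first exact: disc_boundedD.
move=> x y xy; have [fx fy] := cf x y xy; have [gx gy] := cg x y xy.
by split; apply: cvgD.
Qed.

Lemma disc_regularM f g : disc_regular f -> disc_regular g ->
  disc_regular (fun x y => f x y * g x y).
Proof.
move=> [bf cf] [bg cg]; split; first exact: disc_boundedM.
move=> x y xy; have [fx fy] := cf x y xy; have [gx gy] := cg x y xy.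
by split; apply: cvgM.
Qed.

Lemma disc_regularN f : disc_regular f -> disc_regular (fun x y => - f x y).
Proof.
move=> [bf cf]; split; first exact: disc_boundedN.
by move=> x y xy; have [fx fy] := cf x y xy; split; apply: cvgN.
Qed.

Lemma disc_regularB f g : disc_regular f -> disc_regular g ->
  disc_regular (fun x y => f x y - g x y).
Proof. by move=> rf rg; apply: disc_regularD => //; exact: disc_regularN. Qed.

Lemma disc_regularX f n : disc_regular f -> disc_regular (fun x y => f x y ^+ n).
Proof.
move=> rf; elim: n => [|n IH]; first exact: disc_regular_cst.
under eq_fun do under eq_fun do rewrite exprS.
exact: disc_regularM.
Qed.

Lemma disc_regular_sum n (f : 'I_n -> R -> R -> R) :
  (forall k, disc_regular (f k)) ->
  disc_regular (fun x y => \sum_(k < n) f k x y).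
Proof.
move=> bf; elim: n f bf => [|n IH] f bf.
  under eq_fun do under eq_fun do rewrite big_ord0.
  exact: disc_regular_cst.
under eq_fun do under eq_fun do rewrite big_ord_recr/=.
by apply: disc_regularD => //; exact: IH.
Qed.

Lemma disc_regularV f (e : R) : 0 < e -> disc_regular f ->
  (forall x y, x ^+ 2 + y ^+ 2 <= rho ^+ 2 -> e <= f x y) ->
  disc_regular (fun x y => (f x y)^-1).
Proof.
move=> e0 [bf cf] fe; split.
  by apply: (disc_boundedV e0) => // x y /ltW; exact: fe.
move=> x y xy; have [fx fy] := cf x y xy.
have fn0 : f x y != 0 by rewrite gt_eqF// (lt_le_trans e0)// fe.
by split; apply: cvgV.
Qed.

Lemma disc_regular_ln f (e : R) : 0 < e -> disc_regular f ->
  (forall x y, x ^+ 2 + y ^+ 2 <= rho ^+ 2 -> e <= f x y) ->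
  disc_regular (fun x y => ln (f x y)).
Proof.
move=> e0 [bf cf] fe; split.
  by apply: (disc_bounded_ln e0) => // x y /ltW; exact: fe.
move=> x y xy; have [fx fy] := cf x y xy.
have fp : 0 < f x y by rewrite (lt_le_trans e0)// fe.
split.
  exact: (@continuous_comp _ _ _ (f^~ y) (@ln R) x fx (continuous_ln fp)).
exact: (@continuous_comp _ _ _ (f x) (@ln R) y fy (continuous_ln fp)).
Qed.

(** The two components of the flux are assumed outward separately, which is stronger than a
    nonnegative total flux, because each partial derivative is integrated along its own chords.
    Fields that are a nonnegative multiple of w on the circle qualify. *)
Lemma divergence_ge0 X Y Xx Yy : disc_regular Xx -> disc_regular Yy ->
  (forall x y, x ^+ 2 + y ^+ 2 <= rho ^+ 2 -> has_deriv (X^~ y) x (Xx x y)) ->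
  (forall x y, x ^+ 2 + y ^+ 2 <= rho ^+ 2 -> has_deriv (Y x) y (Yy x y)) ->
  (forall x y, x ^+ 2 + y ^+ 2 = rho ^+ 2 -> 0 <= x * X x y) ->
  (forall x y, x ^+ 2 + y ^+ 2 = rho ^+ 2 -> 0 <= y * Y x y) ->
  0 <= disc_int rho (fun x y => Xx x y + Yy x y).
Proof.
move=> [bX cX] [bY cY] dX dY sX sY; rewrite disc_intD//; apply: addr_ge0.
  by apply: (disc_int_ge0_x rho0 bX dX) => // x y /cX[].
by apply: (disc_int_ge0_y rho0 bY dY) => // x y /cY[].
Qed.

Lemma divergence_eq0 X Y Xx Yy : disc_regular Xx -> disc_regular Yy ->
  (forall x y, x ^+ 2 + y ^+ 2 <= rho ^+ 2 -> has_deriv (X^~ y) x (Xx x y)) ->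
  (forall x y, x ^+ 2 + y ^+ 2 <= rho ^+ 2 -> has_deriv (Y x) y (Yy x y)) ->
  (forall x y, x ^+ 2 + y ^+ 2 = rho ^+ 2 -> X x y = 0) ->
  (forall x y, x ^+ 2 + y ^+ 2 = rho ^+ 2 -> Y x y = 0) ->
  disc_int rho (fun x y => Xx x y + Yy x y) = 0.
Proof.
move=> rX rY dX dY sX sY; apply/eqP; rewrite eq_le; apply/andP; split; last first.
  apply: (@divergence_ge0 X Y) => // x y xy; rewrite ?sX ?sY ?mulr0//.
rewrite -oppr_ge0 -mulN1r -disc_intZ//; last by apply: disc_boundedD; [case: rX|case: rY].
rewrite (@eq_disc_int _ _ _ (fun x y => - Xx x y + - Yy x y)); last first.
  by move=> x y _; ring.
apply: (@divergence_ge0 (fun x y => - X x y) (fun x y => - Y x y)).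
- exact: disc_regularN.
- exact: disc_regularN.
- by move=> x y xy; apply: has_derivN; exact: dX.
- by move=> x y xy; apply: has_derivN; exact: dY.
- by move=> x y xy; rewrite sX// oppr0 mulr0.
- by move=> x y xy; rewrite sY// oppr0 mulr0.
Qed.

(* The field [(rho^2 - |w|^2) grad f - f grad (rho^2 - |w|^2)] has divergence
   [(rho^2 - |w|^2) Laplacian f + 4 f] and equals [2 f w] on the circle. *)
Lemma green_ge0 f fx fy fxx fyy :
  disc_regular f -> disc_regular fx -> disc_regular fy ->
  disc_regular fxx -> disc_regular fyy ->
  (forall x y, x ^+ 2 + y ^+ 2 <= rho ^+ 2 -> has_deriv (f^~ y) x (fx x y)) ->
  (forall x y, x ^+ 2 + y ^+ 2 <= rho ^+ 2 -> has_deriv (f x) y (fy x y)) ->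
  (forall x y, x ^+ 2 + y ^+ 2 <= rho ^+ 2 -> has_deriv (fx^~ y) x (fxx x y)) ->
  (forall x y, x ^+ 2 + y ^+ 2 <= rho ^+ 2 -> has_deriv (fy x) y (fyy x y)) ->
  (forall x y, x ^+ 2 + y ^+ 2 = rho ^+ 2 -> 0 <= f x y) ->
  0 <= disc_int rho (fun x y =>
    (rho ^+ 2 - (x ^+ 2 + y ^+ 2)) * (fxx x y + fyy x y) + 4 * f x y).
Proof.
move=> rf rfx rfy rfxx rfyy dfx dfy dfxx dfyy f0.
pose om x y := rho ^+ 2 - (x ^+ 2 + y ^+ 2).
have rom : disc_regular om.
  apply: disc_regularB; first exact: disc_regular_cst.
  apply: disc_regularD; apply: disc_regularX; [exact: disc_regular_fst|exact: disc_regular_snd].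
pose Xx x y := om x y * fxx x y + 2 * f x y.
pose Yy x y := om x y * fyy x y + 2 * f x y.
have r2 g : disc_regular g -> disc_regular (fun x y => om x y * g x y + 2 * f x y).
  move=> rg; apply: disc_regularD; first exact: (disc_regularM rom).
  by apply: (disc_regularM _ rf); exact: disc_regular_cst.
rewrite (@eq_disc_int _ _ _ (fun x y => Xx x y + Yy x y)); last first.
  by move=> x y _; rewrite /Xx /Yy /om; ring.
apply: (@divergence_ge0 (fun x y => om x y * fx x y + f x y * (2 * x))
                        (fun x y => om x y * fy x y + f x y * (2 * y))).
- exact: r2.
- exact: r2.
- move=> x y xy; apply: has_deriv_eq.
    apply: has_derivD; apply: has_derivM; last 2 first.
    + exact: dfx.
    + by apply: has_derivZ; exact: has_deriv_id.
    + apply: has_derivB; first exact: has_deriv_cst.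
      apply: has_derivD; last exact: has_deriv_cst.
      by apply: has_derivX; exact: has_deriv_id.
    + exact: dfxx.
  by rewrite /Xx /om/=; ring.
- move=> x y xy; apply: has_deriv_eq.
    apply: has_derivD; apply: has_derivM; last 2 first.
    + exact: dfy.
    + by apply: has_derivZ; exact: has_deriv_id.
    + apply: has_derivB; first exact: has_deriv_cst.
      apply: has_derivD; first exact: has_deriv_cst.
      by apply: has_derivX; exact: has_deriv_id.
    + exact: dfyy.
  by rewrite /Yy /om/=; ring.
- move=> x y xy; rewrite /om xy subrr mul0r add0r.
  have -> : x * (f x y * (2 * x)) = 2 * (f x y * x ^+ 2) by ring.
  by apply: mulr_ge0 => //; apply: mulr_ge0; [exact: f0|exact: sqr_ge0].
- move=> x y xy; rewrite /om xy subrr mul0r add0r.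
  have -> : y * (f x y * (2 * y)) = 2 * (f x y * y ^+ 2) by ring.
  by apply: mulr_ge0 => //; apply: mulr_ge0; [exact: f0|exact: sqr_ge0].
Qed.

Definition normsq x y := x ^+ 2 + y ^+ 2.

Lemma disc_regular_normsq : disc_regular normsq.
Proof.
by apply: disc_regularD; apply: disc_regularX;
  [exact: disc_regular_fst|exact: disc_regular_snd].
Qed.

Lemma has_deriv_normsq_x x y : has_deriv (normsq^~ y) x (2 * x).
Proof.
apply: has_deriv_eq.
  apply: has_derivD; last exact: has_deriv_cst.
  by apply: has_derivX; exact: has_deriv_id.
by rewrite /=; ring.
Qed.

Lemma has_deriv_normsq_y x y : has_deriv (normsq x) y (2 * y).
Proof.
apply: has_deriv_eq.
  apply: has_derivD; first exact: has_deriv_cst.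
  by apply: has_derivX; exact: has_deriv_id.
by rewrite /=; ring.
Qed.

(** The field [(|w|^(2n+2) - rho^(2n+2)) w] vanishes on the circle and has divergence
    [2 ((n+2) |w|^(2n+2) - rho^(2n+2))], which reduces the moment of order n+1 to the area. *)
Lemma disc_int_normsqX n : disc_int rho (fun x y => normsq x y ^+ n) =
  pi * rho ^+ 2 * rho ^+ (2 * n) / n.+1%:R.
Proof.
have rn k : disc_regular (fun x y => normsq x y ^+ k).
  by apply: disc_regularX; exact: disc_regular_normsq.
case: n => [|n].
  rewrite muln0 !mulr1 divr1 -disc_area//.
have -> : disc_int rho (fun x y => normsq x y ^+ n.+1) = (n.+2%:R)^-1 *
  disc_int rho (fun x y => n.+2%:R * normsq x y ^+ n.+1).
  by rewrite disc_intZ//; [rewrite mulKf|case: (rn n.+1)].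
apply/eqP; rewrite -subr_eq0; apply/eqP.
have -> : pi * rho ^+ 2 * rho ^+ (2 * n.+1) / n.+2%:R =
   n.+2%:R^-1 * disc_int rho (fun x y => rho ^+ (2 * n.+1) * 1).
  rewrite disc_intZ//; last exact: disc_bounded_cst.
  by rewrite disc_area//; ring.
rewrite -mulrBr -disc_intB//; last 2 first.
- apply: disc_boundedM; first exact: disc_bounded_cst.
  by case: (rn n.+1).
- exact: disc_bounded_cst.
set I := disc_int _ _; suff -> : I = 0 by rewrite mulr0.
apply: (mulfI (x := 2)) => //; rewrite mulr0 -disc_intZ//; last first.
  apply: disc_boundedB; last exact: disc_bounded_cst.
  apply: disc_boundedM; first exact: disc_bounded_cst.
  by case: (rn n.+1).
pose Xx x y := normsq x y ^+ n.+1 - rho ^+ (2 * n.+1) + x * (n.+1%:R * normsq x y ^+ n * (2 * x)).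
pose Yy x y := normsq x y ^+ n.+1 - rho ^+ (2 * n.+1) + y * (n.+1%:R * normsq x y ^+ n * (2 * y)).
rewrite (@eq_disc_int _ _ _ (fun x y => Xx x y + Yy x y)); last first.
  move=> x y _; rewrite /Xx /Yy [in LHS]exprS [in RHS]exprS /normsq -[n.+2]addn1 natrD; ring.
have rc c : disc_regular (fun _ _ => c) := disc_regular_cst c.
have rr g : disc_regular g -> disc_regular (fun x y =>
    normsq x y ^+ n.+1 - rho ^+ (2 * n.+1) + g x y * (n.+1%:R * normsq x y ^+ n * (2 * g x y))).
  move=> rg; apply: disc_regularD; first exact: disc_regularB.
  by apply: disc_regularM => //; do 2 apply: disc_regularM => //.
apply: (@divergence_eq0 (fun x y => x * (normsq x y ^+ n.+1 - rho ^+ (2 * n.+1)))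
                        (fun x y => y * (normsq x y ^+ n.+1 - rho ^+ (2 * n.+1)))).
- by apply: rr; exact: disc_regular_fst.
- by apply: rr; exact: disc_regular_snd.
- move=> x y xy; apply: has_deriv_eq.
    apply: has_derivM; first exact: has_deriv_id.
    apply: has_derivB; last exact: has_deriv_cst.
    by apply: has_derivX; exact: has_deriv_normsq_x.
  by rewrite /Xx/=; ring.
- move=> x y xy; apply: has_deriv_eq.
    apply: has_derivM; first exact: has_deriv_id.
    apply: has_derivB; last exact: has_deriv_cst.
    by apply: has_derivX; exact: has_deriv_normsq_y.
  by rewrite /Yy/=; ring.
- by move=> x y xy; rewrite /normsq xy exprM subrr mulr0.
- by move=> x y xy; rewrite /normsq xy exprM subrr mulr0.
Qed.

End Divergence.

(** * The Cauchy and Poisson kernels *)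

Section CauchyKernel.
Context {R : realType}.
Implicit Types (a b x y : R).

(* For [alpha = a + ib] and [w = x + iy]: [1 - alpha w = kre - i kim], and
   [1 / (1 - alpha w) = cre + i cim]. *)
Definition kre a b x y : R := 1 - (a * x - b * y).
Definition kim a b x y : R := a * y + b * x.
Definition kden a b x y : R := kre a b x y ^+ 2 + kim a b x y ^+ 2.
Definition cre a b x y : R := kre a b x y * (kden a b x y)^-1.
Definition cim a b x y : R := kim a b x y * (kden a b x y)^-1.
(* Real and imaginary parts of [alpha / (1 - alpha w)^2] and of its derivative
   [2 alpha^2 / (1 - alpha w)^3]. *)
Definition cdre a b x y : R :=
  a * (cre a b x y ^+ 2 - cim a b x y ^+ 2) - b * (2 * (cre a b x y * cim a b x y)).
Definition cdim a b x y : R :=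
  b * (cre a b x y ^+ 2 - cim a b x y ^+ 2) + a * (2 * (cre a b x y * cim a b x y)).
Definition cddre a b x y : R :=
  a * (2 * (cre a b x y * cdre a b x y - cim a b x y * cdim a b x y)) -
  b * (2 * (cdre a b x y * cim a b x y + cre a b x y * cdim a b x y)).

Variables (r rho : R).
Hypotheses (r0 : 0 <= r) (rho0 : 0 < rho) (rrho : r * rho < 1).

Section OneNode.
Variables a b : R.
Hypothesis ab : a ^+ 2 + b ^+ 2 = r ^+ 2.

Lemma kdenE x y : kden a b x y =
  1 - 2 * (a * x - b * y) + r ^+ 2 * (x ^+ 2 + y ^+ 2).
Proof. by rewrite /kden /kre /kim -ab; ring. Qed.

Lemma kmod_le x y : x ^+ 2 + y ^+ 2 <= rho ^+ 2 -> `|a * x - b * y| <= r * rho.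
Proof.
move=> xy; have rr : 0 <= r * rho by rewrite mulr_ge0// ltW.
rewrite -(ler_pXn2r (n := 2)) ?nnegrE// real_normK ?num_real//.
have -> : (r * rho) ^+ 2 = (a ^+ 2 + b ^+ 2) * rho ^+ 2 by rewrite ab exprMn.
have A : 0 <= a ^+ 2 + b ^+ 2 by rewrite addr_ge0 ?sqr_ge0.
apply: (@le_trans _ _ ((a ^+ 2 + b ^+ 2) * (x ^+ 2 + y ^+ 2))).
  by have := sqr_ge0 (a * y + b * x); nra.
exact: ler_wpM2l.
Qed.

Lemma kden_ge x y : x ^+ 2 + y ^+ 2 <= rho ^+ 2 ->
  (1 - r * rho) ^+ 2 <= kden a b x y.
Proof.
(* [kden >= kre^2] and [kre >= 1 - r rho]. *)
move=> xy; have := kmod_le xy; rewrite ler_norml => /andP[_ le].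
have h0 : 0 <= 1 - r * rho by rewrite subr_ge0 ltW.
rewrite /kden -[leLHS]addr0 lerD ?sqr_ge0// ler_pXn2r ?nnegrE// /kre; lra.
Qed.

Lemma kden_gt0 x y : x ^+ 2 + y ^+ 2 <= rho ^+ 2 -> 0 < kden a b x y.
Proof.
by move=> xy; rewrite (lt_le_trans _ (kden_ge xy))// exprn_gt0// subr_gt0.
Qed.

Lemma kden_le x y : x ^+ 2 + y ^+ 2 <= rho ^+ 2 -> kden a b x y <= 4.
Proof.
move=> xy; have := kmod_le xy; rewrite ler_norml kdenE => /andP[le _].
have rr : 0 <= r * rho by rewrite mulr_ge0// ltW.
have : r ^+ 2 * (x ^+ 2 + y ^+ 2) <= (r * rho) ^+ 2.
  by rewrite exprMn ler_wpM2l ?sqr_ge0.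
have : (r * rho) ^+ 2 <= 1 by rewrite expr_le1// ltW.
have := rrho; lra.
Qed.

Lemma has_deriv_kre_x x y : has_deriv ((kre a b)^~ y) x (- a).
Proof.
apply: has_deriv_eq.
  apply: has_derivB; first exact: has_deriv_cst.
  apply: has_derivB; last exact: has_deriv_cst.
  by apply: has_derivZ; exact: has_deriv_id.
by ring.
Qed.

Lemma has_deriv_kre_y x y : has_deriv (kre a b x) y b.
Proof.
apply: has_deriv_eq.
  apply: has_derivB; first exact: has_deriv_cst.
  apply: has_derivB; first exact: has_deriv_cst.
  by apply: has_derivZ; exact: has_deriv_id.
by ring.
Qed.

Lemma has_deriv_kim_x x y : has_deriv ((kim a b)^~ y) x b.
Proof.
apply: has_deriv_eq.
  apply: has_derivD; first exact: has_deriv_cst.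
  by apply: has_derivZ; exact: has_deriv_id.
by ring.
Qed.

Lemma has_deriv_kim_y x y : has_deriv (kim a b x) y a.
Proof.
apply: has_deriv_eq.
  apply: has_derivD; last exact: has_deriv_cst.
  by apply: has_derivZ; exact: has_deriv_id.
by ring.
Qed.

Lemma has_deriv_kden_x x y : has_deriv ((kden a b)^~ y) x
  (2 * (b * kim a b x y - a * kre a b x y)).
Proof.
apply: has_deriv_eq.
  by apply: has_derivD; apply: has_derivX;
    [exact: has_deriv_kre_x|exact: has_deriv_kim_x].
by rewrite /=; ring.
Qed.

Lemma has_deriv_kden_y x y : has_deriv (kden a b x) y
  (2 * (a * kim a b x y + b * kre a b x y)).
Proof.
apply: has_deriv_eq.
  by apply: has_derivD; apply: has_derivX;
    [exact: has_deriv_kre_y|exact: has_deriv_kim_y].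
by rewrite /=; ring.
Qed.

Section Derivatives.
Variables (x y : R).
Hypothesis xy : x ^+ 2 + y ^+ 2 <= rho ^+ 2.
Let d0 : kden a b x y != 0. Proof. by rewrite gt_eqF// kden_gt0. Qed.

Lemma has_deriv_cre_x : has_deriv ((cre a b)^~ y) x (cdre a b x y).
Proof.
apply: has_deriv_eq.
  apply: has_derivM; first exact: has_deriv_kre_x.
  by apply: has_derivV; [exact: d0|exact: has_deriv_kden_x].
by move: d0; rewrite /cdre /cre /cim /kden/= => ?; field.
Qed.

Lemma has_deriv_cim_x : has_deriv ((cim a b)^~ y) x (cdim a b x y).
Proof.
apply: has_deriv_eq.
  apply: has_derivM; first exact: has_deriv_kim_x.
  by apply: has_derivV; [exact: d0|exact: has_deriv_kden_x].
by move: d0; rewrite /cdim /cre /cim /kden/= => ?; field.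
Qed.

(** Cauchy-Riemann: the y-derivative of a holomorphic function is i times its complex derivative, so
    [cdre] and [cdim] serve in both directions. *)
Lemma has_deriv_cre_y : has_deriv (cre a b x) y (- cdim a b x y).
Proof.
apply: has_deriv_eq.
  apply: has_derivM; first exact: has_deriv_kre_y.
  by apply: has_derivV; [exact: d0|exact: has_deriv_kden_y].
by move: d0; rewrite /cdim /cre /cim /kden/= => ?; field.
Qed.

Lemma has_deriv_cim_y : has_deriv (cim a b x) y (cdre a b x y).
Proof.
apply: has_deriv_eq.
  apply: has_derivM; first exact: has_deriv_kim_y.
  by apply: has_derivV; [exact: d0|exact: has_deriv_kden_y].
by move: d0; rewrite /cdre /cre /cim /kden/= => ?; field.
Qed.

Lemma has_deriv_cdre_x : has_deriv ((cdre a b)^~ y) x (cddre a b x y).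
Proof.
apply: has_deriv_eq.
  apply: has_derivB; apply: has_derivZ.
    by apply: has_derivB; apply: has_derivX; [exact: has_deriv_cre_x|exact: has_deriv_cim_x].
  by apply: has_derivZ; apply: has_derivM; [exact: has_deriv_cre_x|exact: has_deriv_cim_x].
by rewrite /cddre/=; ring.
Qed.

(** The same value as the x-derivative of [cdre]; these two cancel in the Laplacian of the Poisson
    kernel, which is how harmonicity enters. *)
Lemma has_deriv_cdim_y : has_deriv (cdim a b x) y (cddre a b x y).
Proof.
apply: has_deriv_eq.
  apply: has_derivD; apply: has_derivZ.
    by apply: has_derivB; apply: has_derivX; [exact: has_deriv_cre_y|exact: has_deriv_cim_y].
  by apply: has_derivZ; apply: has_derivM; [exact: has_deriv_cre_y|exact: has_deriv_cim_y].
by rewrite /cddre/=; ring.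
Qed.

End Derivatives.

Lemma disc_regular_kre : disc_regular rho (kre a b).
Proof.
apply: disc_regularB; first exact: disc_regular_cst.
by apply: disc_regularB; apply: disc_regularM;
  try exact: disc_regular_cst; [exact: disc_regular_fst|exact: disc_regular_snd].
Qed.

Lemma disc_regular_kim : disc_regular rho (kim a b).
Proof.
by apply: disc_regularD; apply: disc_regularM;
  try exact: disc_regular_cst; [exact: disc_regular_snd|exact: disc_regular_fst].
Qed.

Lemma disc_regular_kden : disc_regular rho (kden a b).
Proof.
by apply: disc_regularD; apply: disc_regularX;
  [exact: disc_regular_kre|exact: disc_regular_kim].
Qed.

Let e0 : 0 < (1 - r * rho) ^+ 2. Proof. by rewrite exprn_gt0// subr_gt0. Qed.

Lemma disc_regular_cre : disc_regular rho (cre a b).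
Proof.
apply: disc_regularM; first exact: disc_regular_kre.
by apply: (disc_regularV e0) => [|x y]; [exact: disc_regular_kden|exact: kden_ge].
Qed.

Lemma disc_regular_cim : disc_regular rho (cim a b).
Proof.
apply: disc_regularM; first exact: disc_regular_kim.
by apply: (disc_regularV e0) => [|x y]; [exact: disc_regular_kden|exact: kden_ge].
Qed.

Let rZ c f : disc_regular rho f -> disc_regular rho (fun x y => c * f x y).
Proof. by move=> rf; apply: disc_regularM => //; exact: disc_regular_cst. Qed.

Let rc := disc_regular_cre.
Let ri := disc_regular_cim.

Lemma disc_regular_cdre : disc_regular rho (cdre a b).
Proof.
apply: disc_regularB; apply: rZ.
  by apply: disc_regularB; exact: disc_regularX.
by apply: rZ; exact: disc_regularM.
Qed.

Lemma disc_regular_cdim : disc_regular rho (cdim a b).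
Proof.
apply: disc_regularD; apply: rZ.
  by apply: disc_regularB; exact: disc_regularX.
by apply: rZ; exact: disc_regularM.
Qed.

Let rd := disc_regular_cdre.
Let re := disc_regular_cdim.

Lemma disc_regular_cddre : disc_regular rho (cddre a b).
Proof.
apply: disc_regularB; apply: rZ; apply: rZ.
  by apply: disc_regularB; exact: disc_regularM.
by apply: disc_regularD; exact: disc_regularM.
Qed.

(* [cre - 1 = Re (alpha w / (1 - alpha w)) = w . grad l] for the harmonic
   function [l = - ln |1 - alpha w|], so it has mean zero against radial weights:
   use the field [(rho^(2n+2) - |w|^(2n+2)) grad l]. *)
Lemma disc_int_normsqX_cre n :
  disc_int rho (fun x y => normsq x y ^+ n * (cre a b x y - 1)) = 0.
Proof.
pose lx x y := a * cre a b x y - b * cim a b x y.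
pose ly x y := - (b * cre a b x y + a * cim a b x y).
have rlx : disc_regular rho lx by apply: disc_regularB; exact: rZ.
have rly : disc_regular rho ly by apply: disc_regularN; apply: disc_regularD; exact: rZ.
have rn k : disc_regular rho (fun x y => normsq x y ^+ k).
  by apply: disc_regularX; exact: disc_regular_normsq.
pose K x y : R := rho ^+ (2 * n.+1) - normsq x y ^+ n.+1.
have rK : disc_regular rho K by apply: disc_regularB => //; exact: disc_regular_cst.
pose m x y := a * cdre a b x y - b * cdim a b x y.
have rm : disc_regular rho m by apply: disc_regularB; exact: rZ.
pose Xx x y := K x y * m x y + lx x y * (- (n.+1%:R * normsq x y ^+ n * (2 * x))).
pose Yy x y := K x y * (- m x y) + ly x y * (- (n.+1%:R * normsq x y ^+ n * (2 * y))).
have E x y : x ^+ 2 + y ^+ 2 < rho ^+ 2 ->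
   normsq x y ^+ n * (cre a b x y - 1) = - (2 * n.+1%:R)^-1 * (Xx x y + Yy x y).
  move=> xy; have d0 : kden a b x y != 0 by rewrite gt_eqF// kden_gt0 ?ltW.
  have n0 : n.+1%:R != 0 :> R by rewrite pnatr_eq0.
  have -> : cre a b x y - 1 = x * lx x y + y * ly x y.
    by move: d0; rewrite /lx /ly /cre /cim /kden /kre /kim => ?; field.
  by rewrite /Xx /Yy; field; rewrite nat1r.
rewrite (eq_disc_int E) disc_intZ//; last first.
  apply: disc_boundedD.
    have [] // : disc_regular rho Xx.
    apply: disc_regularD; first exact: disc_regularM.
    apply: disc_regularM => //; apply: disc_regularN; apply: disc_regularM; first exact: rZ.
    by apply: rZ; exact: disc_regular_fst.
  have [] // : disc_regular rho Yy.
  apply: disc_regularD; first by apply: disc_regularM => //; exact: disc_regularN.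
  apply: disc_regularM => //; apply: disc_regularN; apply: disc_regularM; first exact: rZ.
  by apply: rZ; exact: disc_regular_snd.
rewrite (@divergence_eq0 _ _ rho0 (fun x y => K x y * lx x y) (fun x y => K x y * ly x y) Xx Yy) ?mulr0//.
- apply: disc_regularD; first exact: disc_regularM.
  apply: disc_regularM => //; apply: disc_regularN; apply: disc_regularM; first exact: rZ.
  by apply: rZ; exact: disc_regular_fst.
- apply: disc_regularD; first by apply: disc_regularM => //; exact: disc_regularN.
  apply: disc_regularM => //; apply: disc_regularN; apply: disc_regularM; first exact: rZ.
  by apply: rZ; exact: disc_regular_snd.
- move=> x y xy; apply: has_deriv_eq.
    apply: has_derivM.
      apply: has_derivB; first exact: has_deriv_cst.
      by apply: has_derivX; exact: has_deriv_normsq_x.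
    by apply: has_derivB; apply: has_derivZ; [exact: has_deriv_cre_x|exact: has_deriv_cim_x].
  by rewrite /Xx /m/=; ring.
- move=> x y xy; apply: has_deriv_eq.
    apply: has_derivM.
      apply: has_derivB; first exact: has_deriv_cst.
      by apply: has_derivX; exact: has_deriv_normsq_y.
    apply: has_derivN.
    by apply: has_derivD; apply: has_derivZ; [exact: has_deriv_cre_y|exact: has_deriv_cim_y].
  by rewrite /Yy /m/=; ring.
- by move=> x y xy; rewrite /K /normsq xy exprM subrr mul0r.
- by move=> x y xy; rewrite /K /normsq xy exprM subrr mul0r.
Qed.

(** This is [Re ((1 + alpha w) / (1 - alpha w))], the Poisson kernel of the disc of radius 1/r.
    Being affine in [cre], it inherits derivatives and radial means from the Cauchy kernel. *)
Definition poisson a b x y : R := 2 * cre a b x y - 1.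

Lemma disc_int_normsqX_poisson n :
  disc_int rho (fun x y => normsq x y ^+ n * poisson a b x y) =
  pi * rho ^+ 2 * rho ^+ (2 * n) / n.+1%:R.
Proof.
have [bn _] : disc_regular rho (fun x y => normsq x y ^+ n).
  by apply: disc_regularX; exact: disc_regular_normsq.
have b1 : disc_bounded rho (fun x y => normsq x y ^+ n * (cre a b x y - 1)).
  apply: disc_boundedM => //; apply: disc_boundedB; first by case: rc.
  exact: disc_bounded_cst.
rewrite (@eq_disc_int _ _ _ (fun x y => normsq x y ^+ n +
    2 * (normsq x y ^+ n * (cre a b x y - 1)))); last by move=> x y _; rewrite /poisson; ring.
rewrite disc_intD//; last by apply: disc_boundedM => //; exact: disc_bounded_cst.
by rewrite disc_intZ// disc_int_normsqX_cre mulr0 addr0 disc_int_normsqX.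
Qed.

Lemma poissonE x y : x ^+ 2 + y ^+ 2 <= rho ^+ 2 ->
  poisson a b x y = (1 - r ^+ 2 * (x ^+ 2 + y ^+ 2)) / kden a b x y.
Proof.
move=> xy; have d0 : kden a b x y != 0 by rewrite gt_eqF// kden_gt0.
rewrite /poisson /cre; apply: (mulIf d0); rewrite mulrBl mulfVK// -mulrA mulfVK//.
by rewrite kdenE /kre; ring.
Qed.

(** A Harnack-type bound. It keeps [V] away from 0 on the closed disc, so that [1 / V] and [ln V]
    are regular there. *)
Lemma poisson_ge x y : x ^+ 2 + y ^+ 2 <= rho ^+ 2 ->
  (1 - (r * rho) ^+ 2) / 4 <= poisson a b x y.
Proof.
move=> xy; rewrite poissonE//.
have d0 := kden_gt0 xy.
have rr : 0 <= r * rho by rewrite mulr_ge0// ltW.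
have A : r ^+ 2 * (x ^+ 2 + y ^+ 2) <= (r * rho) ^+ 2.
  by rewrite exprMn ler_wpM2l ?sqr_ge0.
have B : 0 <= 1 - (r * rho) ^+ 2 by rewrite subr_ge0 expr_le1// ltW.
apply: ler_pM => //; first by rewrite lerD2l lerN2.
by rewrite lef_pV2 ?posrE// kden_le.
Qed.

End OneNode.
End CauchyKernel.

(** * The entropy inequality *)

Section EntropyInequality.
Context {R : realType}.
Implicit Types (x y : R).

Lemma disc_bounded_le rho sig (f : R -> R -> R) : 0 < sig -> sig <= rho ->
  disc_bounded rho f -> disc_bounded sig f.
Proof.
move=> s0 sr [mf [M fM]].
have le : sig ^+ 2 <= rho ^+ 2 by rewrite ler_pXn2r ?nnegrE ?(ltW s0)// (le_trans (ltW s0)).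
split; last by exists M => x y xy; apply: fM; exact: lt_le_trans xy le.
apply: measurable_funS mf; first exact: measurable_disc.
by move=> p; rewrite /disc/= => h; exact: lt_le_trans h le.
Qed.

Lemma ge0_disc_int_le rho sig (f : R -> R -> R) : 0 < sig -> sig <= rho ->
  disc_bounded rho f -> (forall x y, x ^+ 2 + y ^+ 2 < rho ^+ 2 -> 0 <= f x y) ->
  disc_int sig f <= disc_int rho f.
Proof.
move=> s0 sr bf f0; have r0 : 0 < rho := lt_le_trans s0 sr.
have le : sig ^+ 2 <= rho ^+ 2 by rewrite ler_pXn2r ?nnegrE ?(ltW s0)// ltW.
have bs := disc_bounded_le s0 sr bf.
rewrite /disc_int /Rintegral fine_le//.
- by apply: integrable_fin_num; [exact: measurable_disc|exact: disc_integrable].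
- by apply: integrable_fin_num; [exact: measurable_disc|exact: disc_integrable].
apply: ge0_subset_integral.
- exact: measurable_disc.
- exact: measurable_disc.
- by apply/measurable_EFinP; case: bf.
- by move=> p; rewrite lee_fin; exact: f0.
- by move=> p; rewrite /disc/= => h; exact: lt_le_trans h le.
Qed.

(** Convexity of [s ln s]: the left side is its tangent line at [t]. Both the log-sum inequality and
    Jensen's inequality are averages of this one. *)
Lemma xlnx_ge (s t : R) : 0 < s -> 0 < t -> s * ln t + s - t <= s * ln s.
Proof.
move=> s0 t0; have ts : 0 < t / s by rewrite divr_gt0.
have := @le_ln1Dx R (t / s - 1); have -> : 1 + (t / s - 1) = t / s by ring.
rewrite ln_div ?posrE// => /(_ _) h.
have {}h : ln t - ln s <= t / s - 1 by apply: h; lra.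
have : s * (ln t - ln s) <= s * (t / s - 1) by rewrite ler_pM2l.
by rewrite [s * (t / s - 1)]mulrBr mulrCA divff ?gt_eqF// !mulr1 mulrBr; lra.
Qed.

Variable N : nat.
Hypothesis N0 : (0 < N)%N.
Definition mean (c : 'I_N -> R) : R := N%:R^-1 * \sum_(k < N) c k.

Let Nr : 0 < N%:R :> R. Proof. by rewrite ltr0n. Qed.

Lemma meanD c d : mean (fun k => c k + d k) = mean c + mean d.
Proof. by rewrite /mean big_split mulrDr. Qed.

Lemma meanZ s c : mean (fun k => s * c k) = s * mean c.
Proof. by rewrite /mean -mulr_sumr mulrCA. Qed.

Lemma meanB c d : mean (fun k => c k - d k) = mean c - mean d.
Proof.
rewrite meanD; congr (_ + _).
by rewrite -mulN1r -meanZ; congr mean; apply/funext => k; rewrite mulN1r.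
Qed.

Lemma mean_cst s : mean (fun _ => s) = s.
Proof.
by rewrite /mean sumr_const card_ord -(mulr_natl s N) mulKf// gt_eqF.
Qed.

Lemma le_mean c d : (forall k, c k <= d k) -> mean c <= mean d.
Proof. by move=> cd; rewrite ler_pM2l ?invr_gt0// ler_sum. Qed.

Lemma mean_gt0 c : (forall k, 0 < c k) -> 0 < mean c.
Proof.
move=> cp; rewrite mulr_gt0 ?invr_gt0//.
rewrite (bigD1 (Ordinal N0))//= ltr_wpDr// sumr_ge0// => k _; exact: ltW.
Qed.

Variables (r rho : R) (a b : 'I_N -> R) (del : R).
Hypotheses (r0 : 0 <= r) (rho1 : 1 < rho) (rrho : r * rho < 1).
Hypothesis ab : forall k, a k ^+ 2 + b k ^+ 2 = r ^+ 2.
Hypothesis Sdel : forall x y, x ^+ 2 + y ^+ 2 = rho ^+ 2 ->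
  mean (fun k => poisson (a k) (b k) x y) <= expR del.

Let rho0 : 0 < rho. Proof. exact: lt_trans rho1. Qed.

Definition hval (c : 'I_N -> R) x y := mean (fun k => c k * poisson (a k) (b k) x y).
(* Real and imaginary parts of the complex derivative [d/dw] of [hval c]. *)
Definition hre (c : 'I_N -> R) x y := mean (fun k => c k * cdre (a k) (b k) x y).
Definition him (c : 'I_N -> R) x y := mean (fun k => c k * cdim (a k) (b k) x y).
Definition hxx (c : 'I_N -> R) x y := mean (fun k => c k * cddre (a k) (b k) x y).

Let rZ s f : disc_regular rho f -> disc_regular rho (fun x y => s * f x y).
Proof. by move=> rf; apply: disc_regularM => //; exact: disc_regular_cst. Qed.

Let rmean (c : 'I_N -> R) f : (forall k, disc_regular rho (f k)) ->
  disc_regular rho (fun x y => mean (fun k => c k * f k x y)).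
Proof. by move=> rf; apply: rZ; apply: disc_regular_sum => k; exact: rZ. Qed.

Lemma disc_regular_hval c : disc_regular rho (hval c).
Proof.
apply: rmean => k; apply: disc_regularB; last exact: disc_regular_cst.
by apply: rZ; exact: (disc_regular_cre r0 rho0 rrho (ab k)).
Qed.

Lemma disc_regular_hre c : disc_regular rho (hre c).
Proof. by apply: rmean => k; exact: (disc_regular_cdre r0 rho0 rrho (ab k)). Qed.

Lemma disc_regular_him c : disc_regular rho (him c).
Proof. by apply: rmean => k; exact: (disc_regular_cdim r0 rho0 rrho (ab k)). Qed.

Lemma disc_regular_hxx c : disc_regular rho (hxx c).
Proof. by apply: rmean => k; exact: (disc_regular_cddre r0 rho0 rrho (ab k)). Qed.

Let dmean (c df : 'I_N -> R) (f : 'I_N -> R -> R) x :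
  (forall k, has_deriv (f k) x (df k)) ->
  has_deriv (fun t => mean (fun k => c k * f k t)) x (mean (fun k => c k * df k)).
Proof.
by move=> hf; apply: has_derivZ; apply: has_deriv_sum => k; exact: has_derivZ.
Qed.

Section DerivativesOfMeans.
Variables (c : 'I_N -> R) (x y : R).
Hypothesis xy : x ^+ 2 + y ^+ 2 <= rho ^+ 2.

Lemma has_deriv_hval_x : has_deriv ((hval c)^~ y) x (2 * hre c x y).
Proof.
apply: has_deriv_eq.
  apply: dmean => k; apply: has_derivB; last exact: has_deriv_cst.
  by apply: has_derivZ; exact: (has_deriv_cre_x r0 rho0 rrho (ab k) xy).
by rewrite -meanZ; congr mean; apply/funext => k; ring.
Qed.

Lemma has_deriv_hval_y : has_deriv (hval c x) y (- 2 * him c x y).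
Proof.
apply: has_deriv_eq.
  apply: dmean => k; apply: has_derivB; last exact: has_deriv_cst.
  by apply: has_derivZ; exact: (has_deriv_cre_y r0 rho0 rrho (ab k) xy).
by rewrite -meanZ; congr mean; apply/funext => k; ring.
Qed.

Lemma has_deriv_hre_x : has_deriv ((hre c)^~ y) x (hxx c x y).
Proof. by apply: dmean => k; exact: (has_deriv_cdre_x r0 rho0 rrho (ab k) xy). Qed.

Lemma has_deriv_him_y : has_deriv (him c x) y (hxx c x y).
Proof. by apply: dmean => k; exact: (has_deriv_cdim_y r0 rho0 rrho (ab k) xy). Qed.

End DerivativesOfMeans.

(** The mean value property against radial weights. The radius [sig] is free because the entropy is
    integrated over radius [rho] and the Cauchy-Schwarz weight over radius 1. *)
Lemma disc_int_normsqX_hval sig c n : 0 < sig -> sig <= rho ->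
  disc_int sig (fun x y => normsq x y ^+ n * hval c x y) =
  pi * sig ^+ 2 * sig ^+ (2 * n) / n.+1%:R * mean c.
Proof.
move=> sig0 sr; have rs : r * sig < 1 by rewrite (le_lt_trans _ rrho)// ler_wpM2l.
have bf k : disc_bounded sig (fun x y => normsq x y ^+ n * poisson (a k) (b k) x y).
  apply: disc_boundedM.
    by apply: disc_boundedX; case: (@disc_regular_normsq R sig sig0).
  apply: disc_boundedB; last exact: disc_bounded_cst.
  apply: disc_boundedM; first exact: disc_bounded_cst.
  by case: (disc_regular_cre r0 sig0 rs (ab k)).
have bc k : disc_bounded sig (fun x y => c k * (normsq x y ^+ n * poisson (a k) (b k) x y)).
  by apply: disc_boundedM => //; exact: disc_bounded_cst.
rewrite (@eq_disc_int _ _ _ (fun x y => N%:R^-1 *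
   \sum_(k < N) c k * (normsq x y ^+ n * poisson (a k) (b k) x y))); last first.
  move=> x y _; rewrite /hval /mean mulrCA; congr (_ * _); rewrite mulr_sumr.
  by apply: eq_bigr => k _; ring.
rewrite disc_intZ//; last exact: disc_bounded_sum.
rewrite disc_int_sum// /mean mulrCA; congr (_ * _); rewrite mulr_sumr.
apply: eq_bigr => k _; rewrite disc_intZ// mulrC.
by rewrite (disc_int_normsqX_poisson r0 sig0 rs (ab k)).
Qed.

Lemma disc_int_hval sig c : 0 < sig -> sig <= rho ->
  disc_int sig (hval c) = pi * sig ^+ 2 * mean c.
Proof.
move=> s0 sr; rewrite (@eq_disc_int _ _ _ (fun x y => normsq x y ^+ 0 * hval c x y)).
  by rewrite disc_int_normsqX_hval// muln0 expr0 mulr1 divr1.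
by move=> x y _; rewrite expr0 mul1r.
Qed.

Variable v : 'I_N -> R.
Hypothesis v0 : forall k, 0 < v k.

Let e0 : R := (1 - (r * rho) ^+ 2) / 4.
Let e0_gt0 : 0 < e0.
Proof. by rewrite divr_gt0// subr_gt0 expr_lt1// mulr_ge0// ltW. Qed.

Let V := hval v.
Let Z := mean v.
Let Z0 : 0 < Z. Proof. exact: mean_gt0. Qed.

Lemma hval_ge x y : x ^+ 2 + y ^+ 2 <= rho ^+ 2 -> e0 * Z <= V x y.
Proof.
move=> xy; rewrite -meanZ; apply: le_mean => k; rewrite mulrC.
by rewrite ler_pM2l//; exact: (poisson_ge r0 rho0 rrho (ab k) xy).
Qed.

Let eZ : 0 < e0 * Z. Proof. exact: mulr_gt0. Qed.

Lemma hval_gt0 x y : x ^+ 2 + y ^+ 2 <= rho ^+ 2 -> 0 < V x y.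
Proof. by move=> /hval_ge; exact: lt_le_trans. Qed.

(** Node values of a harmonic function that dominates [V ln V] on the circle of radius [rho]; the
    term in [del] pays for kernels of total mass above 1. *)
Let w k := v k * ln (v k) + del * v k.

(* The log-sum inequality: with weights [p_k = P_k / N] of total mass
   [S <= e^del], [V ln (V / S) <= sum p_k v_k ln v_k]. *)
Lemma log_sum_ineq x y : x ^+ 2 + y ^+ 2 = rho ^+ 2 ->
  V x y * ln (V x y) <= hval w x y.
Proof.
move=> xy; have xy' : x ^+ 2 + y ^+ 2 <= rho ^+ 2 by rewrite xy.
pose P k := poisson (a k) (b k) x y.
have P0 k : 0 < P k.
  by rewrite (lt_le_trans e0_gt0)//; exact: (poisson_ge r0 rho0 rrho (ab k) xy').
pose S := mean P; have S0 : 0 < S := mean_gt0 P0.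
have V0 : 0 < V x y := hval_gt0 xy'.
pose t := V x y / S; have t0 : 0 < t by rewrite divr_gt0.
have lS : ln S <= del.
  by rewrite -(expRK del) ler_ln ?posrE ?expR_gt0// Sdel.
have H : mean (fun k => (v k * ln t + v k - t) * P k) <=
         mean (fun k => v k * ln (v k) * P k).
  by apply: le_mean => k; rewrite ler_pM2r// xlnx_ge.
have E1 : mean (fun k => (v k * ln t + v k - t) * P k) = V x y * ln t.
  transitivity (mean (fun k => (ln t + 1) * (v k * P k) - t * P k)).
    by congr mean; apply/funext => k; ring.
  rewrite meanB !meanZ -/S -/(V x y) /t.
  by rewrite -/(hval v x y) -/V mulfVK ?gt_eqF//; ring.
have E2 : hval w x y = mean (fun k => v k * ln (v k) * P k) + del * V x y.
  rewrite /V /hval -meanZ -meanD; congr mean; apply/funext => k.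
  by rewrite /w /P; ring.
rewrite E2 (le_trans _ (lerD H (lexx _)))// E1 /t ln_div ?posrE//.
by rewrite mulrBr -addrA lerDl -subr_ge0 mulrC -[X in _ <= X]/(_ + _) ; nra.
Qed.

Let ent := mean (fun k => v k * ln (v k)) + del * Z - Z * ln Z.

Let rV := disc_regular_hval v.
Let rA := disc_regular_hre v.
Let rB := disc_regular_him v.
Let rH := disc_regular_hxx v.
Let rVi : disc_regular rho (fun x y => (V x y)^-1).
Proof. by apply: (disc_regularV eZ) => //; exact: hval_ge. Qed.
Let rlV : disc_regular rho (fun x y => ln (V x y)).
Proof. by apply: (disc_regular_ln eZ) => //; exact: hval_ge. Qed.

(** Green's formula for [f = hval w - V ln V], nonnegative on the circle, with Laplacian [- |grad
    V|^2 / V = - 4 (hre^2 + him^2) / V]. The integral of [f] is at most [pi rho^2 ent]: the harmonic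
    part is computed from its mean, and Jensen's inequality bounds [V ln V] from below. *)
Lemma entropy_bound :
  disc_int rho (fun x y => (rho ^+ 2 - (x ^+ 2 + y ^+ 2)) *
     ((hre v x y ^+ 2 + him v x y ^+ 2) * (V x y)^-1)) <= pi * rho ^+ 2 * ent.
Proof.
pose f x y := hval w x y - V x y * ln (V x y).
pose fx x y := 2 * hre w x y - (1 + ln (V x y)) * (2 * hre v x y).
pose fy x y := - 2 * him w x y - (1 + ln (V x y)) * (- 2 * him v x y).
pose fxx x y := 2 * hxx w x y - ((2 * hre v x y) ^+ 2 * (V x y)^-1 +
  (1 + ln (V x y)) * (2 * hxx v x y)).
pose fyy x y := - 2 * hxx w x y - ((- 2 * him v x y) ^+ 2 * (V x y)^-1 +
  (1 + ln (V x y)) * (- 2 * hxx v x y)).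
have rl1 : disc_regular rho (fun x y => 1 + ln (V x y)).
  by apply: disc_regularD => //; exact: disc_regular_cst.
have rF : disc_regular rho (fun x y => V x y * ln (V x y)) by exact: disc_regularM.
have rf : disc_regular rho f.
  by apply: disc_regularB => //; exact: disc_regular_hval.
have rfx : disc_regular rho fx.
  apply: disc_regularB; first by apply: rZ; exact: disc_regular_hre.
  by apply: disc_regularM => //; exact: rZ.
have rfy : disc_regular rho fy.
  apply: disc_regularB; first by apply: rZ; exact: disc_regular_him.
  by apply: disc_regularM => //; exact: rZ.
have rfxx : disc_regular rho fxx.
  apply: disc_regularB; first by apply: rZ; exact: disc_regular_hxx.
  apply: disc_regularD; apply: disc_regularM => //; last exact: rZ.
  by apply: disc_regularX; exact: rZ.
have rfyy : disc_regular rho fyy.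
  apply: disc_regularB; first by apply: rZ; exact: disc_regular_hxx.
  apply: disc_regularD; apply: disc_regularM => //; last exact: rZ.
  by apply: disc_regularX; exact: rZ.
have := @green_ge0 R rho rho0 f fx fy fxx fyy rf rfx rfy rfxx rfyy.
move=> G; have {}G : 0 <= disc_int rho (fun x y =>
    (rho ^+ 2 - (x ^+ 2 + y ^+ 2)) * (fxx x y + fyy x y) + 4 * f x y).
  apply: G => x y xy.
  - apply: has_deriv_eq.
      apply: has_derivB; first exact: has_deriv_hval_x.
      apply: has_derivM; first exact: has_deriv_hval_x.
      by apply: has_deriv_ln; [exact: hval_gt0|exact: has_deriv_hval_x].
    by rewrite /fx -/V/=; field; rewrite gt_eqF// hval_gt0.
  - apply: has_deriv_eq.
      apply: has_derivB; first exact: has_deriv_hval_y.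
      apply: has_derivM; first exact: has_deriv_hval_y.
      by apply: has_deriv_ln; [exact: hval_gt0|exact: has_deriv_hval_y].
    by rewrite /fy -/V/=; field; rewrite gt_eqF// hval_gt0.
  - apply: has_deriv_eq.
      apply: has_derivB; first by apply: has_derivZ; exact: has_deriv_hre_x.
      apply: has_derivM.
        apply: has_derivD; first exact: has_deriv_cst.
        by apply: has_deriv_ln; [exact: hval_gt0|exact: has_deriv_hval_x].
      by apply: has_derivZ; exact: has_deriv_hre_x.
    by rewrite /fxx -/V/=; field; rewrite gt_eqF// hval_gt0.
  - apply: has_deriv_eq.
      apply: has_derivB; first by apply: has_derivZ; exact: has_deriv_him_y.
      apply: has_derivM.
        apply: has_derivD; first exact: has_deriv_cst.
        by apply: has_deriv_ln; [exact: hval_gt0|exact: has_deriv_hval_y].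
      by apply: has_derivZ; exact: has_deriv_him_y.
    by rewrite /fyy -/V/=; field; rewrite gt_eqF// hval_gt0.
  - by rewrite subr_ge0 log_sum_ineq.
pose om x y := rho ^+ 2 - (x ^+ 2 + y ^+ 2).
pose Q x y := om x y * ((hre v x y ^+ 2 + him v x y ^+ 2) * (V x y)^-1).
have [bQ _] : disc_regular rho Q.
  apply: disc_regularM.
    apply: disc_regularB; first exact: disc_regular_cst.
    exact: disc_regular_normsq.
  by apply: disc_regularM => //; apply: disc_regularD; exact: disc_regularX.
have [bf _] := rf; have [bF _] := rF; have [bW _] := disc_regular_hval w.
(* All terms in [hxx] cancel in [fxx + fyy] by harmonicity, which leaves only the gradient term. *)
move: G; rewrite (@eq_disc_int _ _ _ (fun x y => 4 * (f x y - Q x y))); last first.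
  move=> x y xy; rewrite /fxx /fyy /Q /om.
  by field; rewrite gt_eqF// hval_gt0// ltW.
rewrite disc_intZ//; last exact: disc_boundedB.
rewrite disc_intB// pmulr_rge0// subr_ge0 => /le_trans; apply.
rewrite /f disc_intB//.
have -> : disc_int rho (fun x y => hval w x y) = pi * rho ^+ 2 * mean w.
  exact: disc_int_hval.
(* Jensen: the tangent line of [s ln s] at [Z]. *)
have J : pi * rho ^+ 2 * (Z * ln Z) <= disc_int rho (fun x y => V x y * ln (V x y)).
  have [bV _] := rV.
  have bcst s : disc_bounded rho (fun _ _ => s) := disc_bounded_cst rho s.
  apply: (@le_trans _ _ (disc_int rho (fun x y => (ln Z + 1) * V x y - Z * 1))).
    rewrite disc_intB//; last exact: disc_boundedM.
    have IV : disc_int rho (fun x y => V x y) = pi * rho ^+ 2 * Z.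
      exact: disc_int_hval.
    rewrite (disc_intZ rho0 _ bV) (disc_intZ rho0 Z (bcst 1)) IV disc_area// le_eqVlt; apply/orP; left.
    by apply/eqP; ring.
  apply: le_disc_int => //.
    by apply: disc_boundedB; [exact: disc_boundedM|exact: bcst].
  move=> x y xy; have := xlnx_ge (hval_gt0 (ltW xy)) Z0; rewrite -/V; lra.
rewrite /ent /w meanD meanZ -/Z; lra.
Qed.

Variables (kap : R) (J : nat).
Let p := rho ^- 2.
(** A truncation of [s^(-1) ln (1 / (1 - s)) = sum s^i / (i + 1)] with a bound for the tail. With a
    finite sum, polynomial radial moments of [V] are all that has to be integrated. *)
Definition geom_log (s : R) n := \sum_(i < n) s ^+ i / i.+1%:R + s ^+ n / (1 - s).

(** Cauchy-Schwarz in its additive form: with [o = 1 - p |w|^2] and [s = |dV/dw|],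
    [kap s <= o s^2 / V + (kap^2 / 4) V / o]. The first term is [p Q], controlled by the entropy;
    the second is expanded in powers of [p |w|^2]. In this form the entropy appears linearly and can
    later be cancelled. *)
Lemma disc_int_grad_bound :
  disc_int 1 (fun x y => kap * Num.sqrt (hre v x y ^+ 2 + him v x y ^+ 2)) <=
  pi * (ent + kap ^+ 2 * geom_log p J * Z / 4).
Proof.
have rho2 : 1 < rho ^+ 2 by rewrite expr_gt1// ltW.
have p0 : 0 < p by rewrite invr_gt0; lra.
have p1 : p < 1 by rewrite invf_lt1//; lra.
have one0 : (0 : R) < 1 by [].
have r1 : 1 <= rho by exact: ltW.
have bb f : disc_regular rho f -> disc_bounded 1 f.
  by move=> [bf _]; exact: (disc_bounded_le one0 r1).
have bcst s : disc_bounded 1 (fun _ _ => s) := disc_bounded_cst 1 s.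
pose S x y := hre v x y ^+ 2 + him v x y ^+ 2.
have S0 x y : 0 <= S x y by rewrite addr_ge0 ?sqr_ge0.
have rS : disc_regular rho S by apply: disc_regularD; exact: disc_regularX.
pose om x y := rho ^+ 2 - (x ^+ 2 + y ^+ 2).
pose Q x y := om x y * (S x y * (V x y)^-1).
have rom : disc_regular rho om.
  apply: disc_regularB; first exact: disc_regular_cst.
  exact: disc_regular_normsq.
have rQ : disc_regular rho Q by do 2 apply: disc_regularM => //.
pose be x y := \sum_(i < J) p ^+ i * (normsq x y ^+ i * V x y).
pose T x y := p * Q x y + kap ^+ 2 / 4 * (be x y + p ^+ J / (1 - p) * V x y).
have bn i : disc_bounded 1 (fun x y => normsq x y ^+ i * V x y).
  apply: disc_boundedM; last exact: bb.
  by apply: disc_boundedX; case: (@disc_regular_normsq R 1).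
have bnp i : disc_bounded 1 (fun x y => p ^+ i * (normsq x y ^+ i * V x y)).
  exact: disc_boundedM.
have bbe : disc_bounded 1 be by exact: disc_bounded_sum.
have bV : disc_bounded 1 V by exact: bb.
have bbV : disc_bounded 1 (fun x y => be x y + p ^+ J / (1 - p) * V x y).
  by apply: disc_boundedD => //; exact: disc_boundedM.
have bQ1 : disc_bounded 1 Q by exact: bb.
have bT : disc_bounded 1 T.
  by apply: disc_boundedD; exact: disc_boundedM.
have bs : disc_bounded 1 (fun x y => Num.sqrt (S x y)).
  have bS := bb _ rS; have [_ [M SM]] := bS.
  have ms : measurable_fun setT (@Num.sqrt R).
    by apply: continuous_measurable_fun; exact: sqrt_continuous.
  apply: (disc_bounded_comp (M := Num.sqrt M) ms bS).
  move=> x y xy; rewrite ger0_norm ?sqrtr_ge0// ler_wsqrtr//.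
  by rewrite (le_trans (ler_norm _))// SM.
apply: (@le_trans _ _ (disc_int 1 T)).
  apply: le_disc_int => //; first exact: disc_boundedM.
  move=> x y; rewrite expr1n => xy.
  have xyr : x ^+ 2 + y ^+ 2 <= rho ^+ 2 by lra.
  have V0 := hval_gt0 xyr; rewrite -/V in V0.
  pose s := Num.sqrt (S x y); have sE : S x y = s ^+ 2 by rewrite sqr_sqrtr.
  have t0 : 0 <= normsq x y by rewrite addr_ge0 ?sqr_ge0.
  have t1 : normsq x y < 1 by [].
  pose o := 1 - p * normsq x y.
  have o0 : 1 - p <= o by rewrite lerD2l lerN2 ler_piMr ?ltW.
  have op : 0 < o by lra.
  have pQ : p * Q x y = o * s ^+ 2 / V x y.
    have -> : o = p * (rho ^+ 2 - (x ^+ 2 + y ^+ 2)).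
      by rewrite mulrBr /o /p mulVf//; lra.
    by rewrite /Q /om sE; ring.
  have beE : be x y = (\sum_(i < J) (p * normsq x y) ^+ i) * V x y.
    by rewrite mulr_suml; apply: eq_bigr => i _; rewrite exprMn mulrA.
  have geo : o * \sum_(i < J) (p * normsq x y) ^+ i = 1 - (p * normsq x y) ^+ J.
    have := subrX1 (p * normsq x y) J => E.
    by rewrite /o -[RHS]opprB E; ring.
  (* The geometric series for [1 / o], whose remainder [(p |w|^2)^J / o] is at most [p^J / (1 - p)]
     on the unit disc. *)
  have ineq : V x y / o <= be x y + p ^+ J / (1 - p) * V x y.
    rewrite beE -mulrDl mulrC ler_pM2r// -[leLHS]mul1r ler_pdivrMr// mulrDl.
    rewrite [X in _ <= X + _]mulrC geo.
    have A : (p * normsq x y) ^+ J <= p ^+ J.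
      apply: lerXn2r; rewrite ?nnegrE ?(ltW p0)//; first by rewrite mulr_ge0// ltW.
      by rewrite ler_piMr// ltW.
    have B : p ^+ J <= p ^+ J / (1 - p) * o.
      rewrite -mulrA ler_peMr ?exprn_ge0 ?(ltW p0)// mulrC ler_pdivlMr ?mul1r//.
      by lra.
    by lra.
  have amgm : kap * s <= o * s ^+ 2 / V x y + kap ^+ 2 / 4 * (V x y / o).
    have -> : o * s ^+ 2 / V x y + kap ^+ 2 / 4 * (V x y / o) =
      kap * s + (2 * o * s - kap * V x y) ^+ 2 / (4 * o * V x y).
      by field; rewrite !gt_eqF.
    rewrite lerDl; apply: divr_ge0; first exact: sqr_ge0.
    apply: ltW; apply: mulr_gt0 => //; exact: mulr_gt0.
  rewrite /T pQ; apply: (le_trans amgm); rewrite lerD2l.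
  by apply: ler_wpM2l => //; apply: divr_ge0 => //; exact: sqr_ge0.
have -> : disc_int 1 T = p * disc_int 1 Q + kap ^+ 2 / 4 *
    disc_int 1 (fun x y => be x y + p ^+ J / (1 - p) * V x y).
  rewrite -(disc_intZ one0 p bQ1) -(disc_intZ one0 _ bbV).
  by apply: disc_intD => //; exact: disc_boundedM.
have -> : pi * (ent + kap ^+ 2 * geom_log p J * Z / 4) =
  p * (pi * rho ^+ 2 * ent) + kap ^+ 2 / 4 * (pi * geom_log p J * Z).
  rewrite /p; field; lra.
apply: lerD.
  (* Since [Q >= 0], its integral over the unit disc is at most that over the disc of radius [rho],
     where the entropy bound lives. *)
  rewrite ler_pM2l//; apply: le_trans entropy_bound.
  apply: ge0_disc_int_le => //; first by case: rQ.
  move=> x y xy; have V0 := hval_gt0 (ltW xy).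
  apply: mulr_ge0; first by rewrite subr_ge0 ltW.
  by apply: divr_ge0 => //; exact: ltW.
rewrite ler_wpM2l ?divr_ge0 ?sqr_ge0//.
rewrite disc_intD//; last exact: disc_boundedM.
have IV : disc_int 1 (fun x y => V x y) = pi * 1 ^+ 2 * Z by exact: disc_int_hval.
rewrite (disc_intZ one0 _ bV) IV expr1n mulr1 /be disc_int_sum//.
rewrite le_eqVlt; apply/orP; left; apply/eqP.
rewrite /geom_log mulrDr mulrDl; congr (_ + _); last by ring.
rewrite mulr_sumr mulr_suml; apply: eq_bigr => i _.
by rewrite (disc_intZ one0 _ (bn i)) disc_int_normsqX_hval// !expr1n !mulr1 -/Z; ring.
Qed.

End EntropyInequality.

(** * Exponential moments at equidistant nodes *)

Section ExponentialMoment.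
Context {R : realType}.
Implicit Types (x y t : R) (m : R -> R -> R).

(* [fre m1 m2 a b + i fim m1 m2 a b] is [z P(m1 + i m2)(z)] at [z = a - i b]. *)
Definition fre m1 m2 (a b : R) : R := pi^-1 *
  disc_int 1 (fun x y => m1 x y * cdre a b x y + m2 x y * cdim a b x y).
Definition fim m1 m2 (a b : R) : R := pi^-1 *
  disc_int 1 (fun x y => m2 x y * cdre a b x y - m1 x y * cdim a b x y).

Variables (m1 m2 : R -> R -> R) (M : R).
Hypotheses (bm1 : disc_bounded 1 m1) (bm2 : disc_bounded 1 m2) (M0 : 0 <= M).
Hypothesis mM : forall x y, x ^+ 2 + y ^+ 2 < 1 -> m1 x y ^+ 2 + m2 x y ^+ 2 <= M ^+ 2.

Variables (N : nat) (r rho : R) (a b : 'I_N -> R) (del : R).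
Hypotheses (N0 : (0 < N)%N) (r0 : 0 <= r) (rho1 : 1 < rho) (rrho : r * rho < 1).
Hypothesis ab : forall k, a k ^+ 2 + b k ^+ 2 = r ^+ 2.
Hypothesis Sdel : forall x y, x ^+ 2 + y ^+ 2 = rho ^+ 2 ->
  mean (fun k => poisson (a k) (b k) x y) <= expR del.

Let one0 : (0 : R) < 1. Proof. by []. Qed.
Let r1 : r * 1 < 1.
Proof. by rewrite (le_lt_trans _ rrho)// ler_wpM2l// ltW. Qed.

Lemma disc_bounded_cdre (c d : R) : c ^+ 2 + d ^+ 2 = r ^+ 2 ->
  disc_bounded 1 (cdre c d).
Proof. by move=> cd; case: (disc_regular_cdre r0 one0 r1 cd). Qed.

Lemma disc_bounded_cdim (c d : R) : c ^+ 2 + d ^+ 2 = r ^+ 2 ->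
  disc_bounded 1 (cdim c d).
Proof. by move=> cd; case: (disc_regular_cdim r0 one0 r1 cd). Qed.

(** For [v = exp (t phi)] the quantity [mean (v ln v)] is itself the pairing of mu with [dV/dw], so
    the gradient bound with [kap = t M] has it on both sides. It cancels and leaves a bound on
    [Z ln Z]. *)
Lemma exp_moment (J : nat) (t l1 l2 : R) : 0 <= t -> l1 ^+ 2 + l2 ^+ 2 = 1 ->
  mean (fun k => expR (t * (l1 * fre m1 m2 (a k) (b k) - l2 * fim m1 m2 (a k) (b k))))
  <= expR (del + (t * M) ^+ 2 * geom_log (rho ^- 2) J / 4).
Proof.
move=> t0 l12.
pose phi k := l1 * fre m1 m2 (a k) (b k) - l2 * fim m1 m2 (a k) (b k).
pose v k := expR (t * phi k).
have v0 k : 0 < v k by exact: expR_gt0.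
pose Z := mean v; have Z0 : 0 < Z by exact: mean_gt0.
have dr k := disc_bounded_cdre (ab k); have di k := disc_bounded_cdim (ab k).
(* [p + i q] is mu multiplied by the unimodular [l1 + i l2], so the bound [M] is preserved. *)
pose p x y := l1 * m1 x y - l2 * m2 x y.
pose q x y := l1 * m2 x y + l2 * m1 x y.
have bZ c f : disc_bounded 1 f -> disc_bounded 1 (fun x y => c * f x y).
  by move=> bf; apply: disc_boundedM => //; exact: disc_bounded_cst.
have bp : disc_bounded 1 p by apply: disc_boundedB; exact: bZ.
have bq : disc_bounded 1 q by apply: disc_boundedD; exact: bZ.
have bk k : disc_bounded 1 (fun x y => p x y * cdre (a k) (b k) x y + q x y * cdim (a k) (b k) x y).
  by apply: disc_boundedD; exact: disc_boundedM.
have phiE k : phi k = pi^-1 *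
    disc_int 1 (fun x y => p x y * cdre (a k) (b k) x y + q x y * cdim (a k) (b k) x y).
  rewrite /phi /fre /fim.
  set A := disc_int _ _; set B := disc_int _ _.
  have -> : l1 * (pi^-1 * A) - l2 * (pi^-1 * B) = pi^-1 * (l1 * A - l2 * B) by ring.
  congr (_ * _).
  have bA : disc_bounded 1 (fun x y => m1 x y * cdre (a k) (b k) x y + m2 x y * cdim (a k) (b k) x y).
    by apply: disc_boundedD; exact: disc_boundedM.
  have bB : disc_bounded 1 (fun x y => m2 x y * cdre (a k) (b k) x y - m1 x y * cdim (a k) (b k) x y).
    by apply: disc_boundedB; exact: disc_boundedM.
  rewrite /A /B -(disc_intZ one0 l1 bA) -(disc_intZ one0 l2 bB) -disc_intB//; [|exact: bZ..].
  by apply: eq_disc_int => x y _; rewrite /p /q; ring.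
have bs : disc_bounded 1 (fun x y => \sum_(k < N) v k *
   (p x y * cdre (a k) (b k) x y + q x y * cdim (a k) (b k) x y)).
  by apply: disc_bounded_sum => k; exact: bZ.
have bhr : disc_bounded 1 (hre a b v).
  by apply: (bZ); apply: disc_bounded_sum => k; exact: bZ.
have bhi : disc_bounded 1 (him a b v).
  by apply: (bZ); apply: disc_bounded_sum => k; exact: bZ.
(* Here [ln (v k) = t phi k], and [phi k] is linear in the kernel of the k-th node; the weighted
   kernels add up to [hre] and [him]. *)
have entE : mean (fun k => v k * ln (v k)) = pi^-1 *
    disc_int 1 (fun x y => t * (p x y * hre a b v x y + q x y * him a b v x y)).
  have b1 : disc_bounded 1 (fun x y => p x y * hre a b v x y + q x y * him a b v x y).
    by apply: disc_boundedD; exact: disc_boundedM.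
  rewrite (disc_intZ one0 t b1).
  rewrite (@eq_disc_int _ _ _ (fun x y => N%:R^-1 * \sum_(k < N) v k *
     (p x y * cdre (a k) (b k) x y + q x y * cdim (a k) (b k) x y))); last first.
    move=> x y _; rewrite /hre /him /mean mulrCA [X in _ + X]mulrCA -mulrDr; congr (_ * _).
    rewrite !mulr_sumr -big_split/=; apply: eq_bigr => k _; ring.
  rewrite (disc_intZ one0 _ bs) disc_int_sum//; last by move=> k; exact: bZ.
  set X := \sum_(k < N) _.
  have -> : pi^-1 * (t * (N%:R^-1 * X)) = N%:R^-1 * ((pi^-1 * t) * X) by ring.
  congr (_ * _); rewrite mulr_sumr; apply: eq_bigr => k _.
  by rewrite (disc_intZ one0 _ (bk k)) /v expRK -/(v k) phiE; ring.
have bsq : disc_bounded 1 (fun x y => Num.sqrt (hre a b v x y ^+ 2 + him a b v x y ^+ 2)).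
  have bS : disc_bounded 1 (fun x y => hre a b v x y ^+ 2 + him a b v x y ^+ 2).
    by apply: disc_boundedD; exact: disc_boundedX.
  have [_ [K SK]] := bS.
  have ms : measurable_fun setT (@Num.sqrt R).
    by apply: continuous_measurable_fun; exact: sqrt_continuous.
  apply: (disc_bounded_comp (M := Num.sqrt K) ms bS) => x y xy.
  rewrite ger0_norm ?sqrtr_ge0// ler_wsqrtr//.
  by rewrite (le_trans (ler_norm _))// SK.
have key : mean (fun k => v k * ln (v k)) <=
    (mean (fun k => v k * ln (v k)) + del * Z - Z * ln Z) +
    (t * M) ^+ 2 * geom_log (rho ^- 2) J * Z / 4.
  rewrite {1}entE mulrC ler_pdivrMr ?pi_gt0// mulrC.
  have tM : 0 <= t * M by exact: mulr_ge0.
  apply: le_trans (disc_int_grad_bound N0 r0 rho1 rrho ab Sdel v0 (t * M) J).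
  apply: le_disc_int => //; [|exact: bZ|].
    by apply: (bZ); apply: disc_boundedD; exact: disc_boundedM.
  move=> x y; rewrite expr1n => xy; rewrite -mulrA ler_wpM2l//.
  set A := hre _ _ _ _ _; set B := him _ _ _ _ _.
  have pq : p x y ^+ 2 + q x y ^+ 2 <= M ^+ 2.
    apply: le_trans (mM xy); rewrite -[leRHS]mul1r -l12 le_eqVlt; apply/orP; left.
    by apply/eqP; rewrite /p /q; ring.
  apply: (le_trans (ler_norm _)); rewrite -sqrtr_sqr.
  have -> : M * Num.sqrt (A ^+ 2 + B ^+ 2) = Num.sqrt (M ^+ 2 * (A ^+ 2 + B ^+ 2)).
    by rewrite sqrtrM ?sqr_ge0// sqrtr_sqr ger0_norm.
  apply: ler_wsqrtr.
  (* Cauchy-Schwarz in the plane, through Lagrange's identity. *)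
  apply: (@le_trans _ _ ((p x y ^+ 2 + q x y ^+ 2) * (A ^+ 2 + B ^+ 2))).
    by have := sqr_ge0 (p x y * B - q x y * A); nra.
  by apply: ler_wpM2r => //; rewrite addr_ge0 ?sqr_ge0.
have {}key : Z * ln Z <= Z * (del + (t * M) ^+ 2 * geom_log (rho ^- 2) J / 4).
  have -> : Z * (del + (t * M) ^+ 2 * geom_log (rho ^- 2) J / 4) =
    del * Z + (t * M) ^+ 2 * geom_log (rho ^- 2) J * Z / 4 by ring.
  by lra.
have lZ : ln Z <= del + (t * M) ^+ 2 * geom_log (rho ^- 2) J / 4 by rewrite -(ler_pM2l Z0).
by rewrite -/phi -/v -/Z -[leLHS]lnK ?posrE// ler_expR.
Qed.

End ExponentialMoment.

(** * Averages of Poisson kernels over equidistant nodes *)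

Section RootsOfUnity.
Context {R : realType}.
Local Open Scope complex_scope.
Implicit Types (s t x y : R) (z : R[i]).

Definition cis t : R[i] := cos t +i* sin t.

Lemma cisD s t : cis (s + t) = cis s * cis t.
Proof. by rewrite /cis cosD sinD; simpc; rewrite [X in _ +i* X]addrC. Qed.

Lemma cis0 : cis 0 = 1.
Proof. by rewrite /cis cos0 sin0. Qed.

Lemma cisX t n : cis t ^+ n = cis (n%:R * t).
Proof.
elim: n => [|n IH]; first by rewrite mul0r cis0.
by rewrite exprS IH -cisD; congr cis; rewrite -[n.+1]addn1 natrD; ring.
Qed.

Lemma cis_2pi : cis (2 * pi) = 1.
Proof. by rewrite /cis mulrC mulr_natr cos2pi sin2pi. Qed.

Lemma cis_neq1 t : 0 < t < 2 * pi -> cis t != 1.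
Proof.
move=> /andP[t0 t2]; rewrite eq_complex/= negb_and; apply/orP; left.
have s0 : 0 < sin (t / 2) by apply: sin_gt0_pi; lra.
have -> : t = (t / 2) *+ 2 by rewrite -mulr_natr; field.
rewrite cos_mulr2n cos2sin2 lt_eqF// -mulr_natr.
by have := exprn_gt0 2 s0; lra.
Qed.

(* Expanding [1 / (1 - y z^k)] modulo [(y z^k)^N = y^N]; the inner sums over
   [k] vanish except for the constant term. *)
Lemma sum_inv_roots (F : fieldType) (y z : F) (N : nat) : (0 < N)%N ->
  z ^+ N = 1 -> (forall j, (0 < j < N)%N -> z ^+ j != 1) -> y ^+ N != 1 ->
  \sum_(k < N) (1 - y * z ^+ k)^-1 = N%:R / (1 - y ^+ N).
Proof.
move=> N0 zN zj yN.
have yz k : (y * z ^+ k) ^+ N = y ^+ N by rewrite exprMn exprAC zN expr1n mulr1.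
have d0 : 1 - y ^+ N != 0 by rewrite subr_eq0 eq_sym.
apply: (mulIf d0); rewrite mulfVK// mulr_suml.
transitivity (\sum_(k < N) \sum_(j < N) y ^+ j * (z ^+ j) ^+ k).
  apply: eq_bigr => k _.
  have E := subrX1 (y * z ^+ k) N; rewrite yz in E.
  have n0 : 1 - y * z ^+ k != 0.
    apply: contra yN => /eqP e; have {}e : y * z ^+ k = 1 by apply/eqP; rewrite eq_sym -subr_eq0 e.
    by rewrite -(yz k) e expr1n.
  have -> : 1 - y ^+ N = (1 - y * z ^+ k) * \sum_(i < N) (y * z ^+ k) ^+ i.
    by rewrite -opprB E -mulNr opprB.
  rewrite mulrA mulVf// mul1r; apply: eq_bigr => j _.
  by rewrite exprMn exprAC.
rewrite exchange_big/= (bigD1 (Ordinal N0))//= [X in _ + X]big1 ?addr0.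
  under eq_bigr do rewrite expr0 expr1n mulr1.
  by rewrite sumr_const card_ord.
move=> j j0; rewrite -mulr_sumr.
have nz : z ^+ j - 1 != 0.
  by rewrite subr_eq0 zj// lt0n ltn_ord andbT; apply: contra j0 => /eqP e; apply/eqP/val_inj.
apply/eqP; rewrite mulf_eq0; apply/orP; right.
by rewrite -(mulrI_eq0 _ (mulfI nz)) -subrX1 exprAC zN expr1n subrr.
Qed.

Definition sqmod z : R := complex.Re z ^+ 2 + complex.Im z ^+ 2.

Lemma sqmodM z z' : sqmod (z * z') = sqmod z * sqmod z'.
Proof. by case: z => a b; case: z' => c d; rewrite /sqmod/=; ring. Qed.

Lemma sqmodX z n : sqmod (z ^+ n) = sqmod z ^+ n.
Proof.
elim: n => [|n IH]; first by rewrite /sqmod/= expr1n expr0n addr0.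
by rewrite !exprS sqmodM IH.
Qed.

Lemma sqmod_cis t : sqmod (cis t) = 1.
Proof. exact: cos2Dsin2. Qed.

Lemma Re_invc_cre (a b x y : R) :
  complex.Re ((1 - (a +i* b) * (x +i* y))^-1) = cre a b x y.
Proof.
rewrite /cre /kden /kre /kim; simpc => /=.
by rewrite -opprD sqrrN.
Qed.

Lemma Re_sum n (f : 'I_n -> R[i]) :
  complex.Re (\sum_(k < n) f k) = \sum_(k < n) complex.Re (f k).
Proof. exact: raddf_sum. Qed.

Variables (r rho : R) (N : nat).
Hypotheses (r0 : 0 <= r) (rho0 : 0 < rho) (rrho : r * rho < 1) (N0 : (0 < N)%N).
Hypothesis RN : (r * rho) ^+ N <= 1 / 3.

(** All estimates are uniform in the offset [th]; averaging over it recovers the whole circle. *)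
Definition node th (k : 'I_N) : R := th + 2 * pi * (k%:R / N%:R).

(** Averaging [1 / (1 - Y z^k)] over the roots of unity gives [1 / (1 - Y^N)], so the mean is again
    a Poisson kernel, at a point of modulus [s = (r rho)^N]. It is at most [(1 + s) / (1 - s)], and
    this is at most 2 exactly when [s <= 1/3]. *)
Lemma mean_poisson_le th x y : x ^+ 2 + y ^+ 2 = rho ^+ 2 ->
  mean (fun k : 'I_N => poisson (r * cos (node th k)) (- (r * sin (node th k))) x y)
  <= expR (ln 2).
Proof.
move=> xy; rewrite lnK ?posrE//.
have Nr : 0 < N%:R :> R by rewrite ltr0n.
pose w : R[i] := x +i* y.
pose Y := r%:C * cis (- th) * w; pose z := cis (- (2 * pi / N%:R)).
pose s := (r * rho) ^+ N; have rr : 0 <= r * rho by rewrite mulr_ge0// ltW.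
have s0 : 0 <= s by exact: exprn_ge0.
have sY : sqmod (Y ^+ N) = s ^+ 2.
  rewrite sqmodX !sqmodM sqmod_cis {1 2}/sqmod/= xy expr0n addr0 mulr1.
  by rewrite -exprMn exprAC.
have [A [B YE]] : exists A B, Y ^+ N = A +i* B by case: (Y ^+ N) => A B; exists A, B.
have AB : A ^+ 2 + B ^+ 2 = s ^+ 2 by rewrite -sY YE.
have s1 : s * 1 < 1 by rewrite mulr1; move: RN; rewrite -/s; lra.
have zN : z ^+ N = 1.
  rewrite cisX; have -> : N%:R * - (2 * pi / N%:R) = - (2 * pi) :> R by field; rewrite gt_eqF.
  by rewrite /cis cosN sinN mulrC mulr_natr cos2pi sin2pi oppr0.
have zj j : (0 < j < N)%N -> z ^+ j != 1.
  move=> /andP[j0 jN]; rewrite cisX.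
  have -> : cis (j%:R * - (2 * pi / N%:R)) = cis (2 * pi - j%:R * (2 * pi / N%:R)).
    by rewrite cisD cis_2pi mul1r mulrN.
  have pi2 : (0 : R) < 2 * pi by apply: mulr_gt0 => //; exact: pi_gt0.
  have J0 : (0 : R) < j%:R * (2 * pi / N%:R).
    by apply: mulr_gt0; [rewrite ltr0n|exact: divr_gt0].
  have J1 : j%:R * (2 * pi / N%:R) < 2 * pi :> R.
    by rewrite mulrA ltr_pdivrMr// mulrC ltr_pM2l// ltr_nat.
  by apply: cis_neq1; apply/andP; split; lra.
have yN : Y ^+ N != 1.
  apply/eqP => e; have := sY; rewrite e /sqmod/= expr1n expr0n addr0 => e1.
  by move: s1 s0; rewrite mulr1; nra.
have H := sum_inv_roots N0 zN zj yN.
have H2 : \sum_(k < N) cre (r * cos (node th k)) (- (r * sin (node th k))) x y =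
   N%:R * cre A B 1 0.
  transitivity (complex.Re (\sum_(k < N) (1 - Y * z ^+ k)^-1)).
    rewrite Re_sum; apply: eq_bigr => k _; rewrite -Re_invc_cre.
    congr (complex.Re (1 - _)^-1).
    have -> : Y * z ^+ k = r%:C * (cis (- th) * z ^+ k) * w by rewrite /Y; ring.
    rewrite cisX -cisD -/w; congr (_ * _).
    have -> : - th + k%:R * - (2 * pi / N%:R) = - node th k.
      by rewrite /node; field; rewrite gt_eqF.
    by rewrite /cis cosN sinN; simpc.
  rewrite H YE -Re_invc_cre -[0 in X in _ = X]/(0 : R).
  have -> : (1 : R) +i* 0 = 1 :> R[i] by [].
  rewrite mulr1 -[N%:R]/(N%:R : R[i]).
  have -> : (N%:R : R[i]) = (N%:R : R)%:C by rewrite rmorph_nat.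
  by case: ((1 - (A +i* B))^-1) => c d; rewrite /=; ring.
have -> : mean (fun k : 'I_N => poisson (r * cos (node th k)) (- (r * sin (node th k))) x y)
    = poisson A B 1 0.
  rewrite /poisson meanB mean_cst// meanZ; congr (2 * _ - 1).
  by rewrite /mean H2 mulKf// gt_eqF.
have x1 : (1 : R) ^+ 2 + 0 ^+ 2 <= 1 ^+ 2 by rewrite expr0n addr0.
rewrite (poissonE s0 ltr01 s1 AB x1) expr1n expr0n addr0 mulr1.
have d0 := kden_gt0 s0 ltr01 s1 AB x1.
rewrite ler_pdivrMr//.
have := kden_ge s0 ltr01 s1 AB x1; rewrite mulr1.
move: RN s1; rewrite -/s mulr1 => ss s1.
have : 1 - s ^+ 2 <= 2 * (1 - s) ^+ 2 by nra.
lra.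
Qed.

End RootsOfUnity.

(** * From exponential moments in finitely many directions to q-th moments *)

Section Moments.
Context {R : realType}.
Implicit Types (x y t q : R).

(** The factor is the maximum of [x^q exp (- t x)], attained at [x = q / t]; the inequality is
    [ln u <= u - 1] at [u = t x / q]. *)
Lemma powR_le_exp x q t : 0 <= x -> 0 < q -> 0 < t ->
  x `^ q <= (q / (expR 1 * t)) `^ q * expR (t * x).
Proof.
move=> x0 q0 t0.
have et : 0 < expR 1 * t by rewrite mulr_gt0 ?expR_gt0.
have [->|xn0] := eqVneq x 0.
  by rewrite powR0 ?gt_eqF// mulr_ge0 ?powR_ge0 ?expR_ge0.
have {xn0}x0 : 0 < x by rewrite lt_neqAle eq_sym xn0.
have qe : 0 < q / (expR 1 * t) by rewrite divr_gt0.
rewrite /powR !gt_eqF// -expRD ler_expR.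
rewrite ln_div ?posrE// lnM ?posrE ?expR_gt0// expRK.
have tx : 0 < t * x / q by rewrite divr_gt0 ?mulr_gt0.
have := @le_ln1Dx R (t * x / q - 1); have -> : 1 + (t * x / q - 1) = t * x / q by ring.
rewrite ln_div ?posrE ?mulr_gt0// lnM ?posrE// => /(_ _) h.
have {}h : ln t + ln x - ln q <= t * x / q - 1 by apply: h; lra.
have : q * (ln t + ln x - ln q) <= q * (t * x / q - 1) by rewrite ler_pM2l.
have -> : q * (t * x / q - 1) = t * x - q by field; rewrite gt_eqF.
by lra.
Qed.

Lemma cos_periodic_nat eta n (j : nat) : n%:R * eta = 2 * pi ->
  cos ((n + j)%:R * eta) = cos (j%:R * eta) /\ sin ((n + j)%:R * eta) = sin (j%:R * eta) :> R.
Proof.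
move=> E; rewrite natrD mulrDl E addrC [2 * pi]mulrC mulr_natr.
by rewrite cosD2pi sinD2pi.
Qed.

(* Maximize [Re (e^(i j eta) (F1 + i F2))] over [j < n]: comparing with the two
   neighbours of the maximizer bounds the imaginary part. *)
Lemma max_direction eta n (F1 F2 : R) : n%:R * eta = 2 * pi -> 0 < eta < pi ->
  exists j : 'I_n, let X := cos (j%:R * eta) * F1 - sin (j%:R * eta) * F2 in
   0 <= X /\ (F1 ^+ 2 + F2 ^+ 2) * (1 + cos eta) <= 2 * X ^+ 2.
Proof.
move=> E eta0.
have n0 : (0 < n)%N.
  case: n E => // /esym/eqP; rewrite mul0r mulf_eq0 (gt_eqF (pi_gt0 R)).
  by rewrite pnatr_eq0.
pose X (j : nat) := cos (j%:R * eta) * F1 - sin (j%:R * eta) * F2.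
have Xper j : X (n + j)%N = X j.
  by rewrite /X; have [-> ->] := cos_periodic_nat j E.
have Xmod j : X (j %% n)%N = X j.
  rewrite [in RHS](divn_eq j n); elim: (j %/ n)%N => [|m IH]; first by rewrite mul0n.
  by rewrite mulSn -addnA Xper.
pose i0 := Ordinal n0.
have [j _ jmax] := @arg_maxP _ _ _ i0 xpredT (fun j : 'I_n => X j) isT.
have Xmax (k : nat) : X k <= X j.
  by rewrite -Xmod; exact: (jmax (Ordinal (ltn_pmod k n0)) isT).
exists j => /=; rewrite -/(X j).
pose th := j%:R * eta; pose Y := sin th * F1 + cos th * F2.
have sE : 0 < sin eta by apply: sin_gt0_pi.
have XY : X j ^+ 2 + Y ^+ 2 = F1 ^+ 2 + F2 ^+ 2.
  rewrite /X /Y -/th; transitivity ((cos th ^+ 2 + sin th ^+ 2) * (F1 ^+ 2 + F2 ^+ 2)); first by ring.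
  by rewrite cos2Dsin2 mul1r.
have Xp : X j.+1 = X j * cos eta - Y * sin eta.
  rewrite /X /Y -[j.+1]addn1 natrD mulrDl mul1r -/th cosD sinD; ring.
(* Modulo [n], the index [n.-1 + j] is the left neighbour [j - 1]. *)
have Xm : X (n.-1 + j)%N = X j * cos eta + Y * sin eta.
  have -> : X (n.-1 + j)%N = cos (th - eta) * F1 - sin (th - eta) * F2.
    rewrite /X; have -> : (n.-1 + j)%:R * eta = (th - eta) + pi *+ 2.
      rewrite -{1}subn1 natrD natrB// /th mulrDl mulrBl E mul1r -mulr_natl; ring.
    by rewrite cosD2pi sinD2pi.
  by rewrite /X /Y -/th cosB sinB; ring.
have A := Xmax j.+1; have B := Xmax (n.-1 + j)%N.
rewrite Xp in A; rewrite Xm in B.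
have c1 := cos2Dsin2 eta.
have cl : cos eta < 1 by have := exprn_gt0 2 sE; nra.
have X0 : 0 <= X j by nra.
split=> //; rewrite -XY.
have Ys : `|Y * sin eta| <= X j * (1 - cos eta) by rewrite ler_norml; lra.
have : (Y * sin eta) ^+ 2 <= (X j * (1 - cos eta)) ^+ 2.
  rewrite -[leLHS]real_normK ?num_real// ler_pXn2r ?nnegrE// mulr_ge0// subr_ge0 ltW.
have -> : (Y * sin eta) ^+ 2 = (1 - cos eta) * (Y ^+ 2 * (1 + cos eta)).
  have -> : (Y * sin eta) ^+ 2 = Y ^+ 2 * sin eta ^+ 2 by ring.
  by rewrite sin2cos2; ring.
have -> : (X j * (1 - cos eta)) ^+ 2 = (1 - cos eta) * (X j ^+ 2 * (1 - cos eta)) by ring.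
rewrite ler_pM2l ?subr_gt0//; lra.
Qed.

(** The best direction depends on the point, so it is replaced by the sum over all directions; this
    is where the factor [n] of the moment bound originates. *)
Lemma powR_sector_le eta n q t (F1 F2 : R) :
  n%:R * eta = 2 * pi -> 0 < eta < pi -> 0 < 1 + cos eta -> 0 < q -> 0 < t ->
  (F1 ^+ 2 + F2 ^+ 2) `^ (q / 2) <=
  (2 / (1 + cos eta)) `^ (q / 2) * (q / (expR 1 * t)) `^ q *
  \sum_(j < n) expR (t * (cos (j%:R * eta) * F1 - sin (j%:R * eta) * F2)).
Proof.
move=> E eta0 c0 q0 t0; have [j [X0 XF]] := max_direction F1 F2 E eta0.
move: X0 XF; set X := _ - _ => X0 XF.
have q2 : 0 <= q / 2 by rewrite divr_ge0 ?ltW.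
apply: (@le_trans _ _ ((2 / (1 + cos eta) * X ^+ 2) `^ (q / 2))).
  apply: ge0_ler_powR => //; rewrite ?nnegrE.
  - by rewrite addr_ge0 ?sqr_ge0.
  - by apply: mulr_ge0; [exact: divr_ge0 (ltW c0)|exact: sqr_ge0].
  - by rewrite mulrAC ler_pdivlMr.
rewrite (@powRM _ (2 / (1 + cos eta)) (X ^+ 2)) ?sqr_ge0 ?divr_ge0 ?(ltW c0)// -mulrA ler_wpM2l ?powR_ge0//.
have -> : (X ^+ 2) `^ (q / 2) = X `^ q.
  by rewrite -powR_mulrn// -powRrM mulrCA divff// mulr1.
apply: (le_trans (powR_le_exp X0 q0 t0)); rewrite ler_wpM2l ?powR_ge0//.
rewrite (bigD1 j)//= lerDl sumr_ge0// => i _; exact: expR_ge0.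
Qed.

Variables (m1 m2 : R -> R -> R) (M : R).
Hypotheses (bm1 : disc_bounded 1 m1) (bm2 : disc_bounded 1 m2) (M0 : 0 < M).
Hypothesis mM : forall x y, x ^+ 2 + y ^+ 2 < 1 -> m1 x y ^+ 2 + m2 x y ^+ 2 <= M ^+ 2.
Variables (N : nat) (r rho : R) (J : nat) (Lam : R).
Hypotheses (r0 : 0 <= r) (rho1 : 1 < rho) (rrho : r * rho < 1) (N0 : (0 < N)%N).
Hypothesis RN : (r * rho) ^+ N <= 1 / 3.
Hypotheses (Lam0 : 0 < Lam) (LamJ : geom_log (rho ^- 2) J <= Lam).
Variables (n : nat) (eta q : R).
Hypotheses (nE : n%:R * eta = 2 * pi) (eta0 : 0 < eta < pi)
  (c0 : 0 < 1 + cos eta) (q0 : 0 < q).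

Definition nodefun th (k : 'I_N) : R :=
  fre m1 m2 (r * cos (node th k)) (- (r * sin (node th k))) ^+ 2 +
  fim m1 m2 (r * cos (node th k)) (- (r * sin (node th k))) ^+ 2.

(* The choice [t^2 = 2 q / (M^2 Lam)] minimizes [t^(-q) exp (t^2 M^2 Lam / 4)]. *)
Lemma moment_bound th :
  mean (fun k => nodefun th k `^ (q / 2)) <=
  (2 / (1 + cos eta)) `^ (q / 2) * (n%:R * 2) *
  (q / (2 * expR 1) * (M ^+ 2 * Lam)) `^ (q / 2).
Proof.
pose t := Num.sqrt (2 * q / (M ^+ 2 * Lam)).
have ML : 0 < M ^+ 2 * Lam by rewrite mulr_gt0 ?exprn_gt0.
have t2 : t ^+ 2 = 2 * q / (M ^+ 2 * Lam) by rewrite sqr_sqrtr// divr_ge0 ?mulr_ge0// ltW.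
have t0 : 0 < t by rewrite sqrtr_gt0 divr_gt0// mulr_gt0.
pose a (k : 'I_N) := r * cos (node th k); pose b (k : 'I_N) := - (r * sin (node th k)).
have ab k : a k ^+ 2 + b k ^+ 2 = r ^+ 2.
  by rewrite /a /b sqrrN !exprMn -mulrDr cos2Dsin2 mulr1.
have Sdel x y : x ^+ 2 + y ^+ 2 = rho ^+ 2 ->
    mean (fun k => poisson (a k) (b k) x y) <= expR (ln 2).
  by apply: mean_poisson_le => //; exact: lt_trans rho1.
pose C := (2 / (1 + cos eta)) `^ (q / 2) * (q / (expR 1 * t)) `^ q.
have C0 : 0 <= C by rewrite mulr_ge0 ?powR_ge0.
pose X j k := cos (j%:R * eta) * fre m1 m2 (a k) (b k) - sin (j%:R * eta) * fim m1 m2 (a k) (b k).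
apply: (@le_trans _ _ (mean (fun k : 'I_N => C * \sum_(j < n) expR (t * X j k)))).
  by apply: le_mean => // k; exact: powR_sector_le.
rewrite meanZ.
have -> : mean (fun k : 'I_N => \sum_(j < n) expR (t * X j k)) =
   \sum_(j < n) mean (fun k : 'I_N => expR (t * X j k)).
  by rewrite /mean exchange_big/= mulr_sumr.
have each (j : 'I_n) : mean (fun k : 'I_N => expR (t * X j k)) <= 2 * expR (q / 2).
  have l12 : cos (j%:R * eta) ^+ 2 + sin (j%:R * eta) ^+ 2 = 1 by exact: cos2Dsin2.
  apply: (le_trans (exp_moment bm1 bm2 (ltW M0) mM N0 r0 rho1 rrho ab Sdel J (ltW t0) l12)).
  rewrite expRD lnK ?posrE// ler_pM2l// ler_expR.
  have -> : q / 2 = (t * M) ^+ 2 * Lam / 4.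
    by rewrite exprMn t2; field; rewrite !gt_eqF.
  by rewrite ler_pM2r// ler_wpM2l// sqr_ge0.
apply: (@le_trans _ _ (C * (n%:R * (2 * expR (q / 2))))).
  rewrite ler_wpM2l//; apply: (@le_trans _ _ (\sum_(j < n) 2 * expR (q / 2))).
    exact: ler_sum.
  by rewrite sumr_const card_ord -[leLHS]mulr_natl.
(* The origin of [(q / 2e)^(q/2)]: both factors are powers of exponent [q / 2], with base
   [e q^2 / (e^2 t^2)] in total. *)
have key : (q / (expR 1 * t)) `^ q * expR (q / 2) = (q / (2 * expR 1) * (M ^+ 2 * Lam)) `^ (q / 2).
  have e1 : 0 < expR 1 :> R := expR_gt0 1.
  have -> : expR (q / 2) = (expR 1) `^ (q / 2).
    by rewrite /powR gt_eqF// expRK mulr1.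
  have -> : (q / (expR 1 * t)) `^ q = ((q / (expR 1 * t)) ^+ 2) `^ (q / 2).
    rewrite -[X in _ = X `^ _]powR_mulrn; last by rewrite divr_ge0 ?mulr_ge0 ?ltW.
    by rewrite -powRrM mulrCA divff// mulr1.
  rewrite -powRM ?sqr_ge0 ?ltW//; congr (_ `^ _).
  have -> : (q / (expR 1 * t)) ^+ 2 = q ^+ 2 / (expR 1 ^+ 2 * t ^+ 2).
    by rewrite !expr2; field; rewrite !gt_eqF.
  by rewrite t2; field; rewrite !gt_eqF.
by rewrite le_eqVlt; apply/orP; left; apply/eqP; rewrite -key /C; ring.
Qed.

End Moments.

(** * The Bergman projection on the circle *)

Section BergmanProjection.
Context {R : realType}.
Local Open Scope complex_scope.
Local Notation plane := (measurableTypeR R * measurableTypeR R)%type.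
Implicit Types (x y a b : R).

Lemma cmod_le_sqmod (z : R[i]) (M : R) : 0 <= M ->
  (cmod z <= M) = (sqmod z <= M ^+ 2).
Proof.
move=> M0; rewrite cmodE -/(sqmod z) -[in LHS](ger0_norm M0) -sqrtr_sqr ler_sqrt//.
exact: sqr_ge0.
Qed.

Lemma disc1E : disc 1 = @unit_disc_coords R.
Proof.
apply/seteqP; split => -[x y]; rewrite /disc /unit_disc_coords /unit_disc /= cmodE /= expr1n;
  by rewrite -[X in Num.sqrt _ < X]sqrtr1 ltr_sqrt ?ltr01.
Qed.

Variable mu : R[i] -> R[i].
Hypothesis hmu : Linfty_disc mu.
Variable M : R.
Hypothesis M0 : 0 < M.
Hypothesis muM : (Linfty_norm_disc mu <= M%:E)%E.

(* [mu], cut off on the null set where [|mu| > M]. *)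
Definition essential_part (part : R[i] -> R) x y : R :=
  if cmod (mu (x +i* y)) <= M then part (mu (x +i* y)) else 0.
Local Notation m1 := (essential_part (@complex.Re R)).
Local Notation m2 := (essential_part (@complex.Im R)).

Let mre : measurable_fun (disc 1) (fun p : plane => complex.Re (mu (of_coords p))).
Proof. by rewrite disc1E; case: hmu. Qed.

Let mim : measurable_fun (disc 1) (fun p : plane => complex.Im (mu (of_coords p))).
Proof. by rewrite disc1E; case: hmu. Qed.

Let mmod : measurable_fun (disc 1) (fun p : plane => cmod (mu (of_coords p))).
Proof.
under eq_fun do rewrite cmodE.
have ms : measurable_fun setT (@Num.sqrt R).
  by apply: continuous_measurable_fun; exact: sqrt_continuous.
apply: (measurableT_comp ms); apply: measurable_funD; exact: measurable_funX.
Qed.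

Lemma sqmod_essential_part x y : m1 x y ^+ 2 + m2 x y ^+ 2 <= M ^+ 2.
Proof.
rewrite /essential_part; case: ifPn => [|_]; first by rewrite cmod_le_sqmod// ltW.
by rewrite expr0n addr0 sqr_ge0.
Qed.

Lemma disc_bounded_essential_part (part : R[i] -> R) : (forall z, part z ^+ 2 <= sqmod z) ->
  measurable_fun (disc 1) (fun p : plane => part (mu (of_coords p))) ->
  disc_bounded 1 (essential_part part).
Proof.
move=> hp mp; split.
  apply: measurable_fun_if => //; first exact: measurable_disc.
  - exact: measurable_fun_ler.
  - by apply: measurable_funS mp; [exact: measurable_disc|exact: subIsetl].
exists M => x y _; rewrite /essential_part; case: ifPn => [|_]; last by rewrite normr0 ltW.
rewrite cmod_le_sqmod ?(ltW M0)// => h.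
rewrite -(ler_pXn2r (n := 2)) ?nnegrE ?(ltW M0)// real_normK ?num_real//.
exact: le_trans (hp _) h.
Qed.

Let bm1 : disc_bounded 1 m1.
Proof. by apply: disc_bounded_essential_part => // z; rewrite lerDl sqr_ge0. Qed.
Let bm2 : disc_bounded 1 m2.
Proof. by apply: disc_bounded_essential_part => // z; rewrite lerDr sqr_ge0. Qed.

Lemma ae_cmod_le : {ae lebesgue2, forall p : plane, disc 1 p ->
  cmod (mu (of_coords p)) <= M}.
Proof.
pose nu := mrestr (@lebesgue2 R) (@measurable_unit_disc_coords R).
have : {ae nu, forall p : plane, cmod (mu (of_coords p)) <= M}.
  move: muM; rewrite /Linfty_norm_disc unlock; case: ifPn => [_ /ess_supP|].
    apply: filterS => p /=; rewrite lee_fin; exact/le_trans/ler_norm.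
  (* For a measure of total mass 0 the sup norm is 0 by convention, and then everything holds almost
     everywhere. *)
  rewrite -leNgt measure_le0 => /eqP nu0 _.
  by exists setT; split.
move=> [B [mB B0 sB]]; exists (B `&` disc 1); split.
- by apply: measurableI => //; exact: measurable_disc.
- by rewrite disc1E; exact: B0.
- move=> p /= np; split.
    by apply: sB => /= h; apply: np.
  by apply: contrapT => nd; apply: np.
Qed.

Lemma Rintegral_essential_part (k1 k2 : R -> R -> R) : disc_bounded 1 k1 -> disc_bounded 1 k2 ->
  \int[lebesgue2]_(p in unit_disc_coords)
    (complex.Re (mu (of_coords p)) * k1 p.1 p.2 + complex.Im (mu (of_coords p)) * k2 p.1 p.2)
  = disc_int 1 (fun x y => m1 x y * k1 x y + m2 x y * k2 x y).
Proof.
move=> b1 b2; rewrite -disc1E /disc_int /Rintegral; congr fine.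
have [mk1 _] := b1; have [mk2 _] := b2.
have [mb _] : disc_bounded 1 (fun x y => m1 x y * k1 x y + m2 x y * k2 x y).
  by apply: disc_boundedD; exact: disc_boundedM.
apply: ae_eq_integral.
- exact: measurable_disc.
- by apply/measurable_EFinP; apply: measurable_funD; exact: measurable_funM.
- exact/measurable_EFinP.
apply: filterS ae_cmod_le => -[x y] h Dp; congr EFin.
by rewrite /essential_part (h Dp).
Qed.

Variable r : R.
Hypotheses (r0 : 0 <= r) (r1 : r < 1).

Section AtPoint.
Variables a b : R.
Hypothesis ab : a ^+ 2 + b ^+ 2 = r ^+ 2.
Let one0 : (0 : R) < 1. Proof. by []. Qed.
Let r11 : r * 1 < 1. Proof. by rewrite mulr1. Qed.

Let kr x y := cre a b x y ^+ 2 - cim a b x y ^+ 2.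
Let ki x y := 2 * (cre a b x y * cim a b x y).

Let bcre : disc_bounded 1 (cre a b).
Proof. by case: (disc_regular_cre r0 one0 r11 ab). Qed.
Let bcim : disc_bounded 1 (cim a b).
Proof. by case: (disc_regular_cim r0 one0 r11 ab). Qed.
Let bkr : disc_bounded 1 kr.
Proof. by apply: disc_boundedB; exact: disc_boundedX. Qed.
Let bki : disc_bounded 1 ki.
Proof.
apply: disc_boundedM; first exact: disc_bounded_cst.
exact: disc_boundedM.
Qed.

(** For z the conjugate of alpha, the Bergman kernel is the conjugate of
    [1 / (1 - alpha w)^2 = kr + i ki]. *)
Lemma bergman_kernelE (c : R[i]) x y :
  c / (1 - (a +i* - b) * (x +i* y)^*) ^+ 2 =
  (complex.Re c * kr x y + complex.Im c * ki x y) +i*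
  (complex.Im c * kr x y - complex.Re c * ki x y).
Proof.
have -> : 1 - (a +i* - b) * (x +i* y)^* = kre a b x y +i* kim a b x y.
  by rewrite /kre /kim; simpc; apply/eqP; rewrite eq_complex/=; apply/andP; split; apply/eqP; ring.
have E : (kre a b x y +i* kim a b x y)^-1 = cre a b x y +i* - cim a b x y.
  by [].
rewrite -exprVn E expr2; case: c => c d; simpc; rewrite /kr /ki.
by apply/eqP; rewrite eq_complex/=; apply/andP; split; apply/eqP; ring.
Qed.

Lemma bergman_projectionE :
  bergman_projection mu (a +i* - b) =
  (pi^-1 * disc_int 1 (fun x y => m1 x y * kr x y + m2 x y * ki x y)) +i*
  (pi^-1 * disc_int 1 (fun x y => m2 x y * kr x y - m1 x y * ki x y)).
Proof.
rewrite /bergman_projection /disc_integral.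
congr (_ * _ +i* (_ * _)).
  rewrite -(Rintegral_essential_part bkr bki); apply: eq_Rintegral => p _.
  by rewrite bergman_kernelE.
rewrite (@eq_disc_int _ _ _ (fun x y => m1 x y * - ki x y + m2 x y * kr x y)); last first.
  by move=> x y _; ring.
rewrite -(Rintegral_essential_part (disc_boundedN bki) bkr); apply: eq_Rintegral => p _.
by rewrite bergman_kernelE /= mulrN addrC.
Qed.

(** Multiplication by z turns the kernel into the conjugate of [alpha / (1 - alpha w)^2], a
    derivative in w, to which the pairing with [dV/dw] applies. *)
Lemma mul_bergman_projectionE :
  (a +i* - b) * bergman_projection mu (a +i* - b) =
  fre m1 m2 a b +i* fim m1 m2 a b.
Proof.
rewrite bergman_projectionE /fre /fim.
set A := disc_int _ _; set B := disc_int 1 (fun x y => _ - _ * ki x y).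
have bA : disc_bounded 1 (fun x y => m1 x y * kr x y + m2 x y * ki x y).
  by apply: disc_boundedD; exact: disc_boundedM.
have bB : disc_bounded 1 (fun x y => m2 x y * kr x y - m1 x y * ki x y).
  by apply: disc_boundedB; exact: disc_boundedM.
have bZ c f : disc_bounded 1 f -> disc_bounded 1 (fun x y => c * f x y).
  by move=> bf; apply: disc_boundedM => //; exact: disc_bounded_cst.
have -> : disc_int 1 (fun x y => m1 x y * cdre a b x y + m2 x y * cdim a b x y) = a * A + b * B.
  rewrite -(disc_intZ one0 a bA) -(disc_intZ one0 b bB) -disc_intD//; [|exact: bZ..].
  by apply: eq_disc_int => x y _; rewrite /cdre /cdim /kr /ki; ring.
have -> : disc_int 1 (fun x y => m2 x y * cdre a b x y - m1 x y * cdim a b x y) = a * B - b * A.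
  rewrite -(disc_intZ one0 a bB) -(disc_intZ one0 b bA) -disc_intB//; [|exact: bZ..].
  by apply: eq_disc_int => x y _; rewrite /cdre /cdim /kr /ki; ring.
simpc; apply/eqP; rewrite eq_complex/=; apply/andP; split; apply/eqP; ring.
Qed.

End AtPoint.

Section Continuity.
Local Notation A := (fun t : R => r * cos t).
Local Notation B := (fun t : R => - (r * sin t)).

Let AB t : A t ^+ 2 + B t ^+ 2 = r ^+ 2.
Proof. by rewrite sqrrN !exprMn -mulrDr cos2Dsin2 mulr1. Qed.
Let one0 : (0 : R) < 1. Proof. by []. Qed.
Let r11 : r * 1 < 1. Proof. by rewrite mulr1. Qed.

Let cA : continuous A.
Proof. by move=> t; apply: cvgM; [exact: cvg_cst|exact: continuous_cos]. Qed.
Let cB : continuous B.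
Proof.
by move=> t; apply: cvgN; apply: cvgM; [exact: cvg_cst|exact: continuous_sin].
Qed.

Let cM (f g : R -> R) : continuous f -> continuous g -> continuous (fun t => f t * g t).
Proof. by move=> cf cg t; apply: cvgM; [exact: cf|exact: cg]. Qed.
Let cD (f g : R -> R) : continuous f -> continuous g -> continuous (fun t => f t + g t).
Proof. by move=> cf cg t; apply: cvgD; [exact: cf|exact: cg]. Qed.
Let cN (f : R -> R) : continuous f -> continuous (fun t => - f t).
Proof. by move=> cf t; apply: cvgN; exact: cf. Qed.
Let cC (c : R) : continuous (fun _ : R => c).
Proof. by move=> t; exact: cvg_cst. Qed.

Section FixedPoint.
Variables x y : R.
Hypothesis xy : x ^+ 2 + y ^+ 2 < 1.

Let xy1 : x ^+ 2 + y ^+ 2 <= 1 ^+ 2. Proof. by rewrite expr1n ltW. Qed.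

Let ckre : continuous (fun t => kre (A t) (B t) x y).
Proof. by apply: cD => //; apply: cN; apply: cD; [|apply: cN]; exact: cM. Qed.
Let ckim : continuous (fun t => kim (A t) (B t) x y).
Proof. by apply: cD; exact: cM. Qed.
Let ckden : continuous (fun t => kden (A t) (B t) x y).
Proof. by apply: cD; apply: cM. Qed.
Let cinv : continuous (fun t => (kden (A t) (B t) x y)^-1).
Proof.
move=> t; apply: cvgV; last exact: ckden.
by rewrite gt_eqF// (kden_gt0 r0 one0 r11 (AB t) xy1).
Qed.
Let ccre : continuous (fun t => cre (A t) (B t) x y).
Proof. exact: cM. Qed.
Let ccim : continuous (fun t => cim (A t) (B t) x y).
Proof. exact: cM. Qed.

Lemma continuous_cdre : continuous (fun t => cdre (A t) (B t) x y).
Proof.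
apply: cD; [|apply: cN]; apply: cM => //.
  by apply: cD; [|apply: cN]; exact: cM.
by apply: cM => //; exact: cM.
Qed.
Lemma continuous_cdim : continuous (fun t => cdim (A t) (B t) x y).
Proof.
apply: cD; apply: cM => //.
  by apply: cD; [|apply: cN]; exact: cM.
by apply: cM => //; exact: cM.
Qed.

(** The modulus of [alpha / (1 - alpha w)^2] is [r / d] with [d = |1 - alpha w|^2 >= (1 - r)^2].
    Uniformity in the angle makes it a dominating constant. *)
Lemma kernel_bound t :
  `|cdre (A t) (B t) x y| <= ((1 - r) ^+ 2)^-1 /\
  `|cdim (A t) (B t) x y| <= ((1 - r) ^+ 2)^-1.
Proof.
have d0 := kden_gt0 r0 one0 r11 (AB t) xy1.
have dg := kden_ge r0 one0 r11 (AB t) xy1; rewrite mulr1 in dg.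
set d := kden _ _ _ _ in d0 dg.
have E : cdre (A t) (B t) x y ^+ 2 + cdim (A t) (B t) x y ^+ 2 = (r / d) ^+ 2.
  have -> : (r / d) ^+ 2 = (A t ^+ 2 + B t ^+ 2) * (cre (A t) (B t) x y ^+ 2 + cim (A t) (B t) x y ^+ 2) ^+ 2.
    rewrite AB exprMn; congr (_ * _); rewrite /cre /cim -/d !exprMn -mulrDl -/(kden _ _ _ _) -/d.
    by field; rewrite gt_eqF.
  by rewrite /cdre /cdim; ring.
have s0 : 0 < (1 - r) ^+ 2 by rewrite exprn_gt0// subr_gt0.
have rd : r / d <= ((1 - r) ^+ 2)^-1.
  rewrite -[leRHS]mul1r; apply: ler_pM => //; [by rewrite invr_ge0 ltW|exact: ltW|].
  by rewrite lef_pV2.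
have rd0 : 0 <= r / d by rewrite divr_ge0// ltW.
split; apply: le_trans rd; rewrite -(ler_pXn2r (n := 2)) ?nnegrE// real_normK ?num_real// -E.
  by rewrite lerDl sqr_ge0.
by rewrite lerDr sqr_ge0.
Qed.

End FixedPoint.

Lemma continuous_disc_int_kernel (n1 n2 : R -> R -> R) :
  disc_bounded 1 n1 -> disc_bounded 1 n2 ->
  continuous (fun t => disc_int 1 (fun x y =>
    n1 x y * cdre (A t) (B t) x y + n2 x y * cdim (A t) (B t) x y)).
Proof.
move=> b1 b2 t.
have [_ [M1 M1P]] := b1; have [_ [M2 M2P]] := b2.
pose K := ((1 - r) ^+ 2)^-1.
have K0 : 0 <= K by rewrite invr_ge0 sqr_ge0.
have tI : t \in ([set` `](t - 1), (t + 1)[] : set R) by rewrite inE/= in_itv/=; lra.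
apply: (@continuity_under_integral R _ _ (@lebesgue2 R)
  (fun t (p : plane) => n1 p.1 p.2 * cdre (A t) (B t) p.1 p.2 + n2 p.1 p.2 * cdim (A t) (B t) p.1 p.2)
  (disc 1) (measurable_disc 1) (t - 1) (t + 1) _ _
  (fun _ => `|M1| * K + `|M2| * K) _ _ t tI).
- move=> s _; apply: (disc_integrable one0 (f := fun x y => n1 x y * cdre (A s) (B s) x y + n2 x y * cdim (A s) (B s) x y)).
  apply: disc_boundedD; apply: disc_boundedM => //.
    by case: (disc_regular_cdre r0 one0 r11 (AB s)).
  by case: (disc_regular_cdim r0 one0 r11 (AB s)).
- apply: aeW => -[x y]; rewrite /disc /= expr1n => xy s _.
  by apply: cD; apply: cM => //; [exact: continuous_cdre|exact: continuous_cdim].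
- exact: (disc_integrable one0 (disc_bounded_cst 1 (`|M1| * K + `|M2| * K))).
- move=> s _; apply: aeW => -[x y] D1 /=.
  have xy : x ^+ 2 + y ^+ 2 < 1 by move: D1; rewrite /disc /= expr1n.
  have [k1 k2] := kernel_bound xy s.
  apply: (le_trans (ler_normD _ _)); rewrite !normrM; apply: lerD; apply: ler_pM => //.
    by apply: (le_trans (M1P _ _ D1)); exact: ler_norm.
  by apply: (le_trans (M2P _ _ D1)); exact: ler_norm.
Qed.

(** Continuity in the angle provides measurability and permits shifting arcs by substitution. *)
Lemma continuous_nodefun_circle :
  continuous (fun t => fre m1 m2 (A t) (B t) ^+ 2 + fim m1 m2 (A t) (B t) ^+ 2).
Proof.
have c1 : continuous (fun t => fre m1 m2 (A t) (B t)).
  by apply: cM => //; exact: continuous_disc_int_kernel.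
have c2 : continuous (fun t => fim m1 m2 (A t) (B t)).
  have -> : (fun t => fim m1 m2 (A t) (B t)) = fun t => pi^-1 * disc_int 1 (fun x y =>
     m2 x y * cdre (A t) (B t) x y + (- m1 x y) * cdim (A t) (B t) x y).
    by apply/funext => t; rewrite /fim; congr (_ * _); apply: eq_disc_int => x y _; rewrite mulNr.
  by apply: cM => //; apply: continuous_disc_int_kernel => //; exact: disc_boundedN.
by apply: cD; exact: cM.
Qed.

End Continuity.
End BergmanProjection.

(** * Choice of parameters *)

Section ParameterChoice.
Context {R : realType}.
Implicit Types (p q r x : R).

Lemma sin_le_id x : 0 <= x -> sin x <= x.
Proof.
move=> x0; have [->|xn0] := eqVneq x 0; first by rewrite sin0.
have {xn0}x0 : 0 < x by rewrite lt_neqAle eq_sym xn0.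
have [c _] : exists2 c, c \in `]0, x[%R & sin x - sin 0 = cos c * (x - 0).
  apply: MVT => //.
  by apply: continuous_subspaceT => y; exact: continuous_sin.
rewrite sin0 !subr0 => ->; rewrite ler_piMl ?cos_le1//; exact: ltW.
Qed.

(** The difference [D] of the two sides vanishes at 0 and has derivative [x^J / (1 - x) >= 0]. *)
Lemma sum_pow_le_ln p J : 0 < p -> p < 1 ->
  \sum_(i < J) p ^+ i.+1 / i.+1%:R <= - ln (1 - p).
Proof.
move=> p0 p1.
pose D x := - ln (1 - x) - \sum_(i < J) (i.+1%:R^-1 * x ^+ i.+1).
have dD x : x < 1 -> has_deriv D x (x ^+ J / (1 - x)).
  move=> x1; have x1' : 0 < 1 - x by rewrite subr_gt0.
  rewrite /D; apply: has_deriv_eq.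
    apply: has_derivB.
      apply: has_derivN; apply: has_deriv_ln; first exact: x1'.
      by apply: has_derivB; [exact: has_deriv_cst|exact: has_deriv_id].
    apply: has_deriv_sum => i; apply: has_derivZ; apply: has_derivX.
    exact: has_deriv_id.
  rewrite (eq_bigr (fun i : 'I_J => x ^+ i)); last first.
    by move=> i _; rewrite /= mulr1 mulKf// pnatr_eq0.
  have E := subrX1 x J.
  apply: (mulIf (lt0r_neq0 x1')); rewrite mulrBl mulfVK ?gt_eqF//.
  have -> : (\sum_(i < J) x ^+ i) * (1 - x) = - ((x - 1) * \sum_(i < J) x ^+ i) by ring.
  by rewrite -E; field; rewrite gt_eqF.
have [c cI] : exists2 c, c \in `]0, p[%R & D p - D 0 = (c ^+ J / (1 - c)) * (p - 0).
  apply: MVT => //.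
    by move=> y; rewrite in_itv/= => /andP[_ yp]; apply: dD; exact: lt_trans yp p1.
  apply: continuous_in_subspaceT => y; rewrite inE/= in_itv/= => /andP[_ yp].
  by apply: has_deriv_continuous (dD y _); exact: le_lt_trans yp p1.
move: cI; rewrite in_itv/= => /andP[c0 cp].
have D0 : D 0 = 0.
  rewrite /D subr0 ln1 oppr0 sub0r big1 ?oppr0// => i _.
  by rewrite expr0n mulr0.
rewrite D0 !subr0 => DE.
have : 0 <= D p.
  rewrite DE; apply: mulr_ge0; last exact: ltW.
  by apply: divr_ge0; [apply: exprn_ge0; exact: ltW|rewrite subr_ge0 ltW// (lt_trans cp)].
rewrite /D subr_ge0; congr (_ <= _); apply: eq_bigr => i _.
by rewrite mulrC.
Qed.

Lemma expr_small x e : 0 <= x -> x < 1 -> 0 < e -> exists n, x ^+ n < e.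
Proof.
move=> x0 x1 e0.
have : (fun n => x ^+ n) @ \oo --> (0 : R) by apply: cvg_expr; rewrite ger0_norm.
move=> /cvgrPdist_lt/(_ e e0)[n _ /(_ n (leqnn n))] /=.
by rewrite sub0r normrN ger0_norm ?exprn_ge0// => h; exists n.
Qed.

(** Take [rho = p^(-1/2)] with [p] slightly above [r^2]. The strict slack in [L1] pays half for
    moving [p], by continuity of [phi], and half for the tail of [geom_log]. *)
Lemma geom_log_approx r L1 : 0 < r -> r < 1 ->
  r ^- 2 * ln (1 / (1 - r ^+ 2)) < L1 ->
  exists rho J, [/\ 1 < rho, r * rho < 1 & geom_log (rho ^- 2) J <= L1].
Proof.
move=> r0 r1 hL.
have p00 : 0 < r ^+ 2 by exact: exprn_gt0.
have p01 : r ^+ 2 < 1 by rewrite expr_lt1// ltW.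
pose phi p := p^-1 * ln (1 / (1 - p)).
have cphi : {for r ^+ 2, continuous phi}.
  have d1 : (1 - r ^+ 2) != 0 by rewrite gt_eqF// subr_gt0.
  apply: (has_deriv_continuous (x := r ^+ 2) (df := _)).
  apply: has_derivM.
    by apply: has_derivV; [rewrite gt_eqF|exact: has_deriv_id].
  apply: has_deriv_ln; first by rewrite divr_gt0// subr_gt0.
  apply: has_derivZ; apply: has_derivV; first exact: d1.
  by apply: has_derivB; [exact: has_deriv_cst|exact: has_deriv_id].
pose L2 := (phi (r ^+ 2) + L1) / 2.
have pL : phi (r ^+ 2) < L2 by rewrite /L2; move: hL; rewrite -/(phi _); lra.
have LL : L2 < L1 by rewrite /L2; move: hL; rewrite -/(phi _); lra.
have [p [p0 p1 rp phip]] : exists p, [/\ 0 < p, p < 1, r ^+ 2 < p & phi p < L2].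
  have : \forall p \near (r ^+ 2), phi p < L2 by exact: (cvgr_lt _ cphi).
  move=> [e /= e0 He].
  pose d := Num.min (e / 2) ((1 - r ^+ 2) / 2).
  have d0 : 0 < d by rewrite lt_min !divr_gt0// subr_gt0.
  have de : d < e by rewrite (le_lt_trans (_ : d <= e / 2))// ?ge_min ?lexx//; lra.
  have d1 : d < 1 - r ^+ 2.
    by rewrite (le_lt_trans (_ : d <= (1 - r ^+ 2) / 2))// ?ge_min ?lexx ?orbT//; lra.
  exists (r ^+ 2 + d); split; [lra|lra|lra|].
  by apply: He; rewrite /= opprD addNKr normrN gtr0_norm.
have e1 : 0 < (L1 - L2) * (1 - p) by rewrite mulr_gt0 ?subr_gt0.
have [J pJ] := expr_small (ltW p0) p1 e1.
exists (Num.sqrt p^-1), J.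
have s2 : (Num.sqrt p^-1) ^+ 2 = p^-1 by rewrite sqr_sqrtr// invr_ge0 ltW.
have s0 : 0 <= Num.sqrt p^-1 by exact: sqrtr_ge0.
split.
- by rewrite -(ltr_pXn2r (n := 2)) ?nnegrE// expr1n s2 invf_gt1.
- rewrite -(ltr_pXn2r (n := 2)) ?nnegrE ?mulr_ge0 ?(ltW r0)// expr1n exprMn s2.
  by rewrite ltr_pdivrMr// mul1r.
rewrite s2 invrK /geom_log.
have A : \sum_(i < J) p ^+ i / i.+1%:R <= phi p.
  rewrite /phi mulrC ler_pdivlMr// mulr_suml.
  rewrite (eq_bigr (fun i : 'I_J => p ^+ i.+1 / i.+1%:R)); last first.
    by move=> i _; rewrite exprSr mulrAC.
  by rewrite div1r lnV ?posrE ?subr_gt0//; exact: sum_pow_le_ln.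
have B : p ^+ J / (1 - p) <= L1 - L2 by rewrite ler_pdivrMr ?subr_gt0// ltW.
lra.
Qed.

(** With [n = 2m] and [eta = pi / m] the first factor is [cos (pi / 2m)^(-q)], at most 3/2. The
    factor 2 is the loss at the nodes and the last 3/2 is reserved for the slack in L. The product
    is at most [9 m <= 9 (q + 4) <= 15 (3 + q)], and [sqrt (3 + q) >= 3/2]. *)
Lemma direction_parameters q : 0 < q -> exists (n : nat) (eta : R),
  [/\ n%:R * eta = 2 * pi, 0 < eta < pi, 0 < 1 + cos eta &
   (2 / (1 + cos eta)) `^ (q / 2) * (n%:R * 2) * (3 / 2) <= 10 * (3 + q) `^ (3 / 2)].
Proof.
move=> q0; have q3 : 0 < 3 + q by lra.
pose m := (Num.trunc q + 4)%N.
have /andP[tq qt] := truncn_itv (ltW q0).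
have mE : m%:R = (Num.trunc q)%:R + 4 :> R by rewrite /m natrD.
have m1 : q + 3 < m%:R by rewrite mE; move: qt; rewrite -[_.+1]addn1 natrD; lra.
have m2 : m%:R <= q + 4 by rewrite mE; lra.
have m0 : 0 < m%:R :> R by lra.
have ppi : 0 < pi :> R := pi_gt0 R.
have pi4 : pi < 4 :> R by have := pihalf_lt2 R; lra.
pose be : R := pi / (2 * m%:R).
have be0 : 0 < be by rewrite divr_gt0// mulr_gt0.
have beE : m%:R * be = pi / 2 by rewrite /be; field; rewrite gt_eqF.
have bem : be <= 2 / m%:R by rewrite ler_pdivlMr//; nra.
pose u := 2 / m%:R ^+ 2 : R.
have m9 : 9 < m%:R ^+ 2 :> R by have := sqr_ge0 (m%:R - 3 : R); lra.
have mm0 : 0 < m%:R ^+ 2 :> R by lra.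
have u0 : 0 < u by rewrite divr_gt0.
have u1 : u < 1 / 4 by rewrite ltr_pdivrMr//; lra.
have um : u * m%:R ^+ 2 = 2 by rewrite /u mulfVK// gt_eqF.
(* [1 - cos be = 2 sin^2 (be / 2)], and [be / 2 <= 1 / m] because [pi < 4]. *)
have cb : 1 - u <= cos be.
  have -> : be = (be / 2) *+ 2 by rewrite -mulr_natr; field.
  rewrite cos_mulr2n cos2sin2 -mulr_natr.
  have s1 := @sin_le_id (be / 2) (divr_ge0 (ltW be0) (ler0n _ 2)).
  have s2 : sin (be / 2) <= m%:R^-1.
    apply: (le_trans s1); have -> : m%:R^-1 = (2 / m%:R) / 2 :> R by field; rewrite gt_eqF.
    by rewrite ler_pM2r.
  have s0 : 0 <= sin (be / 2).
    apply: sin_ge0_pi; apply/andP; split; first by rewrite divr_ge0// ltW.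
    have : be * m%:R >= be * 1 by rewrite ler_pM2l//; lra.
    by move: beE; lra.
  have : sin (be / 2) ^+ 2 <= (m%:R^-1) ^+ 2.
    by rewrite ler_pXn2r ?nnegrE ?invr_ge0 ?(ltW m0).
  by rewrite exprVn -/u /u; lra.
pose eta := be *+ 2.
have cE : 1 + cos eta = 2 * cos be ^+ 2 by rewrite /eta cos_mulr2n -mulr_natl; ring.
have cb0 : 0 < cos be by lra.
have c0 : 0 < 1 + cos eta by rewrite cE mulr_gt0// exprn_gt0.
exists (2 * m)%N, eta; split => //.
- by rewrite /eta natrM -mulr_natl; move: beE; lra.
- rewrite /eta -mulr_natl; apply/andP; split; first by rewrite mulr_gt0.
  have : be * 3 < be * m%:R by rewrite ltr_pM2l//; lra.
  by move: beE; lra.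
have A : (2 / (1 + cos eta)) `^ (q / 2) <= 3 / 2.
  have B : 2 / (1 + cos eta) <= expR (4 * u).
    have -> : 4 * u = 2 * u + 2 * u by ring.
    rewrite expRD cE ler_pdivrMr ?mulr_gt0 ?exprn_gt0//.
    have e1 : 1 + 2 * u <= expR (2 * u) := expR_ge1Dx _.
    have e2 : 1 <= expR (2 * u) * cos be.
      apply: (@le_trans _ _ ((1 + 2 * u) * (1 - u))); first by nra.
      by apply: ler_pM => //; lra.
    have : 1 * 1 <= (expR (2 * u) * cos be) * (expR (2 * u) * cos be) by rewrite ler_pM.
    by lra.
  have h : 2 / (1 + cos eta) >= 0 by rewrite divr_ge0// ltW.
  apply: (le_trans (ge0_ler_powR _ _ _ B)); rewrite ?nnegrE ?divr_ge0 ?expR_ge0 ?(ltW q0)//.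
  rewrite /powR gt_eqF ?expR_gt0// expRK.
  (* This is [12 q <= m^2], which follows from [m > q + 3] and [(q - 3)^2 >= 0]. *)
  have C : q / 2 * (4 * u) <= 1 / 3.
    have h1 : (q + 3) ^+ 2 <= m%:R ^+ 2.
      by rewrite ler_pXn2r ?nnegrE ?(ltW m1)//; lra.
    have : q * 12 <= m%:R ^+ 2 by have := sqr_ge0 (q - 3); lra.
    rewrite -(ler_pM2l u0) [u * m%:R ^+ 2]mulrC; move: um; lra.
  apply: (@le_trans _ _ (expR (1 / 3))); first by rewrite ler_expR.
  have := expR_ge1Dx (- (1 / 3) : R); rewrite expRN.
  have E0 := expR_gt0 (1 / 3 : R).
  move=> E1; have : (1 + - (1 / 3)) * expR (1 / 3) <= 1 :> R.
    by rewrite -ler_pdivlMr// [1 / expR _]div1r.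
  by lra.
have S : (3 + q) `^ (3 / 2) = (3 + q) * Num.sqrt (3 + q).
  have -> : 3 / 2 = 1 + 2^-1 :> R by field.
  rewrite powRD; last by rewrite (gt_eqF q3) implybT.
  by rewrite powRr1 ?(ltW q3)// powR12_sqrt// ltW.
have S1 : 3 / 2 <= Num.sqrt (3 + q).
  have -> : 3 / 2 = Num.sqrt ((3 / 2) ^+ 2) :> R by rewrite sqrtr_sqr ger0_norm//; lra.
  by apply: ler_wsqrtr; lra.
rewrite S natrM.
apply: (@le_trans _ _ (3 / 2 * (2 * m%:R * 2) * (3 / 2))).
  by rewrite ler_pM2r ?ler_pM2r//; do ?apply: mulr_gt0 => //.
apply: (@le_trans _ _ (10 * ((3 + q) * (3 / 2)))); first by lra.
by rewrite ler_pM2l// ler_pM2l.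
Qed.

End ParameterChoice.

(** * The integral over the circle *)

Section CircleIntegral.
Context {R : realType}.

(** The point 0 is treated apart, since for [p < 1] the power is not differentiable there. *)
Lemma continuous_norm_powR (p : R) : 0 < p -> continuous (fun s : R => `|s| `^ p).
Proof.
move=> p0 s; have [->|s0] := eqVneq s 0.
  rewrite /continuous_at normr0 powR0 ?gt_eqF//; apply/cvgrPdist_lt => e e0.
  near=> x; rewrite sub0r normrN ger0_norm ?powR_ge0//.
  have -> : e = (e `^ p^-1) `^ p by rewrite -powRrM mulVf ?gt_eqF// powRr1// ltW.
  rewrite gt0_ltr_powR// ?nnegrE ?powR_ge0//.
  near: x; exists (e `^ p^-1) => /=; first exact: powR_gt0.
  by move=> y /=; rewrite sub0r normrN.
have s1 : 0 < `|s| by rewrite normr_gt0.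
apply: (@continuous_comp _ _ _ (fun s : R => `|s|) (fun s => s `^ p)).
  exact: norm_continuous.
have d : has_deriv (fun s : R => s `^ p) `|s| _ := @is_derive1_powR R p `|s| s1.
exact: has_deriv_continuous d.
Unshelve. all: by end_near. Qed.

Variable f : R -> R.
Hypotheses (cf : continuous f) (f0 : forall t, 0 <= f t).

Let mf (D : set R) : measurable D -> measurable_fun D (fun t => (f t)%:E).
Proof.
by move=> mD; apply/measurable_EFinP; apply: measurable_funTS;
  exact: continuous_measurable_fun.
Qed.

Lemma integral_shift (c L : R) : 0 <= L ->
  (\int[lebesgue_measure]_(t in `[c, (c + L)%R]) (f t)%:E =
   \int[lebesgue_measure]_(t in `[0%R, L]) (f (t + c)%R)%:E)%E.
Proof.
move=> L0.
have dF (x : R) : has_deriv (fun t => t + c) x 1.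
  rewrite -[X in has_deriv _ _ X]addr0.
  by apply: has_derivD; [exact: has_deriv_id|exact: has_deriv_cst].
have derF : (fun t : R => t + c)^`()%classic = fun _ => 1.
  by apply/funext => x; rewrite derive1E; exact: (@derive_val _ _ _ _ _ _ _ (dF x)).
have cF : continuous (fun t : R => t + c) by move=> x; exact: has_deriv_continuous (dF x).
have := @integration_by_substitution_increasing R (fun t => t + c) f 0 L L0.
rewrite add0r [L + c]addrC => ->.
- by apply: eq_integral => x _; rewrite derF /= mulr1.
- by move=> x y _ _ xy; rewrite ltrD2r.
- by rewrite derF => x _; exact: cvg_cst.
- by rewrite derF; exact: is_cvg_cst.
- by rewrite derF; exact: is_cvg_cst.
- split.
  + by move=> x _; have [] := dF x.
  + by apply: cvg_at_right_filter; exact: cF.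
  + by apply: cvg_at_left_filter; exact: cF.
- exact: continuous_subspaceT.
Qed.

Lemma integral_arcs (L : R) n : 0 <= L ->
  (\int[lebesgue_measure]_(t in `[0%R, (n%:R * L)%R]) (f t)%:E =
   \sum_(k < n) \int[lebesgue_measure]_(t in `[0%R, L]) (f (t + k%:R * L)%R)%:E)%E.
Proof.
move=> L0; elim: n => [|n IH]; first by rewrite big_ord0 mul0r set_itv1 integral_set1.
rewrite big_ord_recr/= -IH -(integral_shift _ L0).
have nL : 0 <= n%:R * L by rewrite mulr_ge0.
have -> : n.+1%:R * L = n%:R * L + L by rewrite -[n.+1]addn1 natrD mulrDl mul1r.
rewrite -(@integral_itv_bndo_bndc R _ (n%:R * L)); last exact: mf.
rewrite -ge0_integral_setU//=.
- congr (integral _ _ _); apply/seteqP; split => x /=; rewrite !in_itv/=.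
    by move=> /andP[-> ->]; case: (ltP x (n%:R * L)) => h; [left|right].
  by case=> /andP[h1 h2]; apply/andP; split; lra.
- by apply: mf; apply: measurableU; exact: measurable_itv.
- by move=> x _; rewrite lee_fin.
- by apply/disj_set2P; rewrite -subset0 => x [] /=; rewrite !in_itv/= => /andP[_ h1] /andP[h2 _]; lra.
Qed.

(** Cutting the circle into N equal arcs and shifting each onto the first leaves the integral over
    one arc of the sum over rotated nodes. *)
Lemma circle_integral_le N (S : R) : (0 < N)%N ->
  (forall t, \sum_(k < N) f (t + 2 * pi * (k%:R / N%:R)) <= N%:R * S) ->
  ((((2 * pi)^-1)%:E *
    \int[lebesgue_measure]_(t in `[0%R, (2 * pi)%R]) (f t)%:E) <= S%:E)%E.
Proof.
move=> N0 fS; have Nr : 0 < N%:R :> R by rewrite ltr0n.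
have p0 : 0 < 2 * pi :> R by rewrite mulr_gt0// pi_gt0.
pose L : R := 2 * pi / N%:R; have L0 : 0 < L by exact: divr_gt0.
have LE : 2 * pi = N%:R * L by rewrite /L; field; rewrite gt_eqF.
rewrite lee_pdivrMl// [in X in `[0%R, X]]LE integral_arcs ?(ltW L0)//.
have mfk k : measurable_fun `[0%R, L] (fun t => (f (t + k%:R * L))%:E).
  apply/measurable_EFinP; apply: measurable_funTS; apply: continuous_measurable_fun.
  move=> t; apply: (@continuous_comp _ _ _ (fun t : R => t + k%:R * L) f); last exact: cf.
  by apply: cvgD; [exact: cvg_id|exact: cvg_cst].
rewrite -ge0_integral_sum//=; last first.
- by move=> k t _; rewrite lee_fin.
- by move=> k; exact: mfk.
apply: (@le_trans _ _ (\int[lebesgue_measure]_(t in `[0%R, L]) (N%:R * S)%:E)%E).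
  apply: ge0_le_integral => //=.
  - by move=> t _; apply: sume_ge0 => k _; rewrite lee_fin.
  - by apply: emeasurable_sum => k; exact: mfk.
  - move=> t _; rewrite sumEFin lee_fin; apply: le_trans (fS t).
    rewrite le_eqVlt; apply/orP; left; apply/eqP; apply: eq_bigr => k _.
    by congr f; rewrite /L; field; rewrite gt_eqF.
rewrite integral_cst//=; have M := lebesgue_measure_itv `[0%R, L].
rewrite [X in (_ * X)%E]M /= lte_fin L0 oppr0 adde0 -!EFinM lee_fin LE.
by rewrite le_eqVlt; apply/orP; left; apply/eqP; ring.
Qed.

End CircleIntegral.

(** * Assembly of the estimate with its constants *)

Section MainEstimate.
Context {R : realType}.
Local Open Scope complex_scope.
Variables (mu g : R[i] -> R[i]).
Hypothesis hmu : Linfty_disc mu.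
Hypothesis hg : forall z, unit_disc z -> g z = bergman_projection mu z.
Variables (q r : R).
Hypotheses (q0 : 0 < q) (r0 : 0 < r) (r1 : r < 1).

(** [M] is any positive bound and not the norm itself, because the optimal [t] is proportional to
    [1 / M] and the norm may be 0. *)
Lemma circle_integral_bound (M : R) : 0 < M -> (Linfty_norm_disc mu <= M%:E)%E ->
  (circle_integral (fun zeta => (cmod (g (r%:C * zeta)) `^ q)%:E) <=
   (10 * (3 + q) `^ (3 / 2) * M `^ q * (q / (2 * expR 1)) `^ (q / 2)
     * (1 / r ^+ 4 * ln (1 / (1 - r ^+ 2))) `^ (q / 2))%:E)%E.
Proof.
move=> M0 muM.
pose m1 := essential_part mu M (@complex.Re R); pose m2 := essential_part mu M (@complex.Im R).
have bm1 : disc_bounded 1 m1.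
  apply: (disc_bounded_essential_part hmu M0) => [z|]; first by rewrite lerDl sqr_ge0.
  by rewrite disc1E; case: hmu.
have bm2 : disc_bounded 1 m2.
  apply: (disc_bounded_essential_part hmu M0) => [z|]; first by rewrite lerDr sqr_ge0.
  by rewrite disc1E; case: hmu.
have mM x y : x ^+ 2 + y ^+ 2 < 1 -> m1 x y ^+ 2 + m2 x y ^+ 2 <= M ^+ 2.
  by move=> _; exact: sqmod_essential_part.
have rr0 : 0 < r ^+ 2 by exact: exprn_gt0.
have rr1 : r ^+ 2 < 1 by rewrite expr_lt1// ltW.
pose l := ln (1 / (1 - r ^+ 2)).
have l0 : 0 < l by rewrite ln_gt0// div1r invf_gt1 ?subr_gt0//; lra.
pose L0 := r ^- 2 * l; have L00 : 0 < L0 by rewrite mulr_gt0// invr_gt0.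
(* A slack factor above 1 that is harmless after raising to the power [q / 2]: it becomes
   [sqrt 2 <= 3/2]. *)
pose c := 2 `^ q^-1 : R; have c0 : 0 < c by exact: powR_gt0.
have c1 : 1 < c.
  rewrite -[ltLHS](powRr0 2) /c /powR gt_eqF// ltr_expR mul0r mulr_gt0 ?invr_gt0//.
  by rewrite ln_gt0//; lra.
have cq : c `^ (q / 2) <= 3 / 2.
  rewrite /c -powRrM mulKf ?gt_eqF// powR12_sqrt//.
  have -> : 3 / 2 = Num.sqrt ((3 / 2) ^+ 2) :> R by rewrite sqrtr_sqr ger0_norm//; lra.
  by apply: ler_wsqrtr; lra.
have Lc : L0 < c * L0 by rewrite ltr_pMl.
have [rho [J [rho1 rrho gJ]]] := geom_log_approx r0 r1 Lc.
have cL0 : 0 < c * L0 by rewrite mulr_gt0.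
have [n [eta [nE eta0 ce0 nC]]] := direction_parameters q0.
have rho0 : 0 < rho by exact: lt_trans rho1.
have [N RN] := expr_small (mulr_ge0 (ltW r0) (ltW rho0)) rrho (e := 1 / 3) ltac:(lra).
have N0 : (0 < N)%N by case: N RN => // ; rewrite expr0; lra.
have mb := moment_bound bm1 bm2 M0 mM (ltW r0) rho1 rrho N0 (ltW RN) cL0 gJ nE eta0 ce0 q0.
pose sq t := fre m1 m2 (r * cos t) (- (r * sin t)) ^+ 2 +
  fim m1 m2 (r * cos t) (- (r * sin t)) ^+ 2.
have sq0 t : 0 <= sq t by rewrite addr_ge0 ?sqr_ge0.
have csq : continuous sq := continuous_nodefun_circle hmu M0 (ltW r0) r1.
(* [D = |z|^(-q)] undoes the multiplication of [g] by z. *)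
pose D := (r ^- 2) `^ (q / 2).
pose f t := D * `|sq t| `^ (q / 2).
have cf : continuous f.
  move=> t; apply: cvgM; first exact: cvg_cst.
  apply: (@continuous_comp _ _ _ sq (fun s => `|s| `^ (q / 2))); first exact: csq.
  by apply: continuous_norm_powR; rewrite divr_gt0.
have f0 t : 0 <= f t by rewrite mulr_ge0 ?powR_ge0.
have fE t : cmod (g (r%:C * (cos t +i* sin t))) `^ q = f t.
  have zE : r%:C * (cos t +i* sin t) = (r * cos t) +i* - (- (r * sin t)).
    by simpc.
  have ab : (r * cos t) ^+ 2 + (- (r * sin t)) ^+ 2 = r ^+ 2.
    by rewrite sqrrN !exprMn -mulrDr cos2Dsin2 mulr1.
  have zs : sqmod (r%:C * (cos t +i* sin t)) = r ^+ 2 by rewrite zE /sqmod/= opprK -ab sqrrN.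
  have zD : unit_disc (r%:C * (cos t +i* sin t)).
    by rewrite /unit_disc/= cmodE -/(sqmod _) zs sqrtr_sqr gtr0_norm.
  have gE : sqmod (g (r%:C * (cos t +i* sin t))) = r ^- 2 * sq t.
    rewrite hg// /sq; have := mul_bergman_projectionE hmu M0 muM (ltW r0) r1 ab.
    rewrite -zE => E; have := congr1 sqmod E; rewrite sqmodM zs.
    rewrite [sqmod (_ +i* _)]/sqmod/= => <-.
    by rewrite mulKf// gt_eqF.
  rewrite cmodE -/(sqmod _) gE -powR12_sqrt; last by rewrite mulr_ge0// invr_ge0 ltW.
  rewrite -powRrM [2^-1 * q]mulrC powRM ?invr_ge0 ?(ltW rr0)//.
  by rewrite /f ger0_norm.
have -> : circle_integral (fun zeta => (cmod (g (r%:C * zeta)) `^ q)%:E) =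
    (((2 * pi)^-1)%:E *
      \int[lebesgue_measure]_(t in `[0%R, (2 * pi)%R]) (f t)%:E)%E.
  by rewrite /circle_integral; congr (_ * _)%E; apply: eq_integral => t _; rewrite fE.
set S := (X in (_ <= X%:E)%E).
apply: (circle_integral_le cf f0 N0) => t.
have Nr : 0 < N%:R :> R by rewrite ltr0n.
have -> : \sum_(k < N) f (t + 2 * pi * (k%:R / N%:R)) =
    N%:R * (D * mean (fun k : 'I_N => nodefun m1 m2 r t k `^ (q / 2))).
  rewrite /mean mulrCA mulVKf ?gt_eqF// mulr_sumr.
  by apply: eq_bigr => k _; rewrite /f ger0_norm.
rewrite ler_pM2l//; apply: (le_trans (ler_wpM2l (powR_ge0 _ _) (mb t))).
have e1 : 0 < expR 1 :> R := expR_gt0 1.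
have qe : 0 <= q / (2 * expR 1) by rewrite divr_ge0 ?mulr_ge0 ?ltW.
have -> : (q / (2 * expR 1) * (M ^+ 2 * (c * L0))) `^ (q / 2) =
   (q / (2 * expR 1)) `^ (q / 2) * (M `^ q * (c `^ (q / 2) * L0 `^ (q / 2))).
  have h1 : 0 <= M ^+ 2 * (c * L0) by exact: mulr_ge0 (sqr_ge0 M) (ltW cL0).
  rewrite (@powRM R _ _ _ qe h1) (@powRM R _ _ _ (sqr_ge0 M) (ltW cL0)).
  rewrite (@powRM R _ _ _ (ltW c0) (ltW L00)); congr (_ * (_ * _)).
  by rewrite -(@powR_mulrn R M 2 (ltW M0)) -powRrM mulrCA divff// mulr1.
have LE : (1 / r ^+ 4 * ln (1 / (1 - r ^+ 2))) `^ (q / 2) = D * L0 `^ (q / 2).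
  have i0 : 0 <= r ^- 2 by rewrite invr_ge0 ltW.
  rewrite /D -(@powRM R _ _ _ i0 (ltW L00)); congr (_ `^ _).
  by rewrite /L0 -/l; field; rewrite gt_eqF.
rewrite /S LE.
set Q := (q / _) `^ _; set K := (2 / _) `^ _ * (_ * 2); set MQ := M `^ q.
have -> : D * (K * (Q * (MQ * (c `^ (q / 2) * L0 `^ (q / 2))))) =
   K * c `^ (q / 2) * (MQ * Q * (D * L0 `^ (q / 2))) by ring.
have P0 : 0 <= MQ * (Q * (D * L0 `^ (q / 2))).
  by rewrite mulr_ge0 ?powR_ge0// mulr_ge0 ?powR_ge0// mulr_ge0 ?powR_ge0.
have KC : K * c `^ (q / 2) <= 10 * (3 + q) `^ (3 / 2).
  apply: le_trans nC; rewrite -/K ler_wpM2l//.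
  by rewrite mulr_ge0 ?powR_ge0// mulr_ge0.
have := ler_wpM2r P0 KC; rewrite !mulrA.
by [].
Qed.

End MainEstimate.

Local Open Scope complex_scope.

Theorem corollary1p7p1 (R : realType) (mu g : R[i] -> R[i])
    (hmu : Linfty_disc mu)
    (hg : forall z, unit_disc z -> g z = bergman_projection mu z)
    (q : R) (hq : 0 < q) (r : R) (hr0 : 0 < r) (hr1 : r < 1) :
  (circle_integral (fun zeta => (cmod (g (r%:C * zeta)) `^ q)%:E) <=
   (10 * (3 + q) `^ (3 / 2) * fine (Linfty_norm_disc mu) `^ q
     * (q / (2 * expR 1)) `^ (q / 2)
     * (1 / r ^+ 4 * ln (1 / (1 - r ^+ 2))) `^ (q / 2))%:E)%E.
Proof.
have bound := circle_integral_bound hmu hg hq hr0 hr1.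
have [_ _ fin] := hmu.
have n0 : (0 <= Linfty_norm_disc mu)%E by exact: Lnorm_ge0.
have nfin : Linfty_norm_disc mu \is a fin_num by rewrite ge0_fin_numE.
set M := fine _; have ME : Linfty_norm_disc mu = M%:E by rewrite fineK.
have M0 : 0 <= M by exact: fine_ge0.
have [Mz|Mn0] := eqVneq M 0; last first.
  by apply: bound; [rewrite lt_neqAle eq_sym Mn0|rewrite ME].
set A := 10 * _; set B := (q / _) `^ _; set C := (_ * ln _) `^ _.
rewrite Mz powR0 ?gt_eqF// mulr0 !mul0r.
have K0 : 0 <= A * B * C by rewrite mulr_ge0 ?powR_ge0// mulr_ge0 ?powR_ge0// mulr_ge0 ?powR_ge0.
apply/lee_addgt0Pr => e e0; rewrite add0e.
(* For norm 0, any [d > 0] is an admissible bound; this one makes the right side at most [e], and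
   the added 1 keeps the denominator positive. *)
pose d := (e / (A * B * C + 1)) `^ q^-1.
have eK : 0 < e / (A * B * C + 1) by rewrite divr_gt0// ltr_wpDl.
have d0 : 0 < d by exact: powR_gt0.
apply: (le_trans (bound d d0 _)); first by rewrite ME Mz lee_fin ltW.
have -> : d `^ q = e / (A * B * C + 1).
  by rewrite /d -powRrM mulVf ?gt_eqF// powRr1// ltW.
rewrite lee_fin -/A -/B -/C.
have -> : A * (e / (A * B * C + 1)) * B * C = e * (A * B * C) / (A * B * C + 1) by ring.
by rewrite ler_pdivrMr ?ltr_wpDl// mulrDr mulr1; lra.
Qed.
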